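(* For $0<p,q<1$, the radius of convergence $R(p,q)$ of $G(x,1,p,q)=\sum_{\pi\in\mathcal D}x^{n(\pi)}p^{w(\pi)}q^{a(\pi)}$, regarded as a power series in $x$, is $$R(p,q)=\min_{k\ge1}x_k(p,q)=\min_{k\geq1}\frac{1}{p^{2k-1}q\,\Lambda_{k+1}(q^2/p^2)}$$ (in particular the minimum is attained). Moreover, fix $r>0$ and, for $0<\sigma<\min(1,r^{-1})$, put $p=\sqrt{\sigma}$ and $q=\sqrt{r\sigma}$. Let $$\sigma_k(r)=\frac{\Lambda_{k+1}(r)}{\Lambda_{k+2}(r)},\qquad k\ge1.$$ As $\sigma$ varies in $0<\sigma<\min(1,r^{-1})$, the set of active branches (the set of indices $k\ge 1$ attaining the minimum above) can change only at neighbouring crossings: it is constant on every subinterval containing none of the values $\sigma_k(r)$, $k\ge1$. Here ties are allowed, i.e. the active branch may be non-unique, and several of the values $\sigma_k(r)$ may coincide. The $k$th adjacent crossing (the set of $(p,q)\in(0,1)^2$ with $x_k(p,q)=x_{k+1}(p,q)$) is parametrised by $$p^2=\sigma_k(r),\qquad q^2=r\,\sigma_k(r),$$ for those $r>0$ for which $\sigma_k(r)<\min\{1,r^{-1}\}$. The family of these transition curves is symmetric under $p\leftrightarrow q$.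
   Context: A Dyck path is a lattice path starting at $(0,0)$, with steps $U=(1,1)$ and $D=(1,-1)$, ending on the line $y=0$ and never visiting a vertex with negative $y$-coordinate; $\mathcal D$ is the set of all Dyck paths (including the empty path). For $\pi\in\mathcal D$ with $2n$ steps, $n(\pi)=n$ is the semi-length; the height $h(\pi)$ is the maximum $y$-coordinate; the proper area $a(\pi)$ is the sum of the starting heights of all steps. Water capacity $w(\pi)$: let $h=h(\pi)$. For each $1\le k\le h$ mark the first up-step $U_k$ of $\pi$ from level $k-1$ to $k$ and the last down-step $D_k$ from level $k$ to $k-1$; they occur in the order $U_1,\dots,U_h,D_h,\dots,D_1$. The portions of $\pi$ strictly between consecutive marked steps are the gaps: for $1\le k<h$ a left gap at level $k$ (between $U_k$ and $U_{k+1}$) and a right gap at level $k$ (between $D_{k+1}$ and $D_k$), and a single top gap at level $h$ (between $U_h$ and $D_h$). A gap at level $k$ starts and ends at height $k$ and never rises above height $k$; reflecting it in the line $y=k$ and translating to the horizontal axis gives a Dyck path of height at most $k$. Then $w(\pi)$ is the sum over all gaps of the proper areas of these reflected Dyck paths (and $w=0$ for the empty path). For $r>0$ and $h\ge1$, $A_h(r)$ is the $h\times h$ real symmetric tridiagonal matrix with zero diagonal and $(A_h(r))_{i,i+1}=(A_h(r))_{i+1,i}=r^{(i-1)/2}$ for $1\le i\le h-1$; $\lambda_h(r)$ is its spectral radius and $\Lambda_h(r)=\lambda_h(r)^2$ (so $\Lambda_1(r)=0$). For $p,q>0$ and $k\ge1$, the $k$th branch is $x_k(p,q)=\dfrac{1}{p^{2k-1}q\,\Lambda_{k+1}(q^2/p^2)}$.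 *)

(* Defs.v *)
From mathcomp Require Import all_boot all_order all_algebra.
From mathcomp Require Import all_classical all_reals all_analysis.
From mathcomp Require Import complex.

Set Implicit Arguments.
Unset Strict Implicit.
Unset Printing Implicit Defensive.

Import Order.TTheory GRing.Theory Num.Theory.
Import numFieldNormedType.Exports.

Local Open Scope classical_set_scope.
Local Open Scope ring_scope.

(* A lattice path is the sequence of its steps: [true] is the up-step U = (1,1)
   and [false] the down-step D = (1,-1).  The [i]-th step (counted from 0) joins
   the [i]-th vertex to the [i.+1]-st one. *)

(* y-coordinate of the [i]-th vertex *)
Definition vheight (s : seq bool) (i : nat) : int :=
  \sum_(b <- take i s) (if b then 1 else -1).

Definition is_dyck (s : seq bool) : bool :=
  all (fun i => 0 <= vheight s i) (iota 0 (size s).+1)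
  && (vheight s (size s) == 0).

(* [height] and [area] take the absolute value of heights only to land in [nat]:
   on a Dyck path no height is negative. *)
Definition height (s : seq bool) : nat :=
  \max_(0 <= i < (size s).+1) `|vheight s i|%N.

Definition area (s : seq bool) : nat :=
  (\sum_(0 <= i < size s) `|vheight s i|)%N.

(* For 1 <= k <= height s, index of the marked step U_k, the first up-step from
   level k - 1 to level k. *)
Definition up_mark (s : seq bool) (k : nat) : nat :=
  find (fun i => nth false s i && (vheight s i == k%:Z - 1)) (iota 0 (size s)).

(* For 1 <= k <= height s, index of the marked step D_k, the last down-step from
   level k to level k - 1. *)
Definition down_mark (s : seq bool) (k : nat) : nat :=
  \max_(0 <= i < size s | ~~ nth true s i && (vheight s i == k%:Z)) i.

(* steps strictly between the [i]-th and the [j]-th one *)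
Definition between (s : seq bool) (i j : nat) : seq bool := drop i.+1 (take j s).

Definition left_gap (s : seq bool) (k : nat) : seq bool :=
  between s (up_mark s k) (up_mark s k.+1).

Definition right_gap (s : seq bool) (k : nat) : seq bool :=
  between s (down_mark s k.+1) (down_mark s k).

Definition top_gap (s : seq bool) : seq bool :=
  between s (up_mark s (height s)) (down_mark s (height s)).

(* Reflecting in a horizontal line exchanges U and D; the translation to the
   axis leaves the steps unchanged. *)
Definition reflect_path (s : seq bool) : seq bool := map negb s.

Definition water (s : seq bool) : nat :=
  if height s == 0%N then 0%N else
  (\sum_(1 <= k < height s)
      (area (reflect_path (left_gap s k)) + area (reflect_path (right_gap s k)))
   + area (reflect_path (top_gap s)))%N.

(* coefficient of x^n in the generating function G(x, 1, p, q) *)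
Definition dyck_coef (R : realType) (p q : R) (n : nat) : R :=
  \sum_(s : (n.*2).-tuple bool | is_dyck s) p ^+ water s * q ^+ area s.

Definition radius_of_convergence (R : realType) (a : nat -> R) : \bar R :=
  ereal_sup [set `|x|%:E | x in [set x : R | cvgn (pseries a x)]].

(* maximal modulus of the complex eigenvalues *)
Definition spectral_radius (R : realType) (n : nat) (A : 'M[R]_n) : R :=
  sup [set ComplexField.Normc.normc z
      | z in [set z : R[i] | eigenvalue (map_mx (real_complex R) A) z]].

(* Rows and columns are numbered from 0, so that the exponent (i-1)/2 of the
   1-based numbering becomes i/2. *)
Definition Amx (R : realType) (h : nat) (r : R) : 'M[R]_h :=
  \matrix_(i < h, j < h)
    if j == i.+1 :> nat then r `^ (i%:R / 2)
    else if i == j.+1 :> nat then r `^ (j%:R / 2)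
    else 0.

Definition Lambda (R : realType) (h : nat) (r : R) : R :=
  spectral_radius (Amx h r) ^+ 2.

Definition branch (R : realType) (k : nat) (p q : R) : R :=
  1 / (p ^+ (2 * k - 1) * q * Lambda k.+1 (q ^+ 2 / p ^+ 2)).

Definition active (R : realType) (p q : R) : set nat :=
  [set k | (1 <= k)%N /\ forall j, (1 <= j)%N -> branch k p q <= branch j p q].

Definition sigma (R : realType) (k : nat) (r : R) : R :=
  Lambda k.+1 r / Lambda k.+2 r.

Definition crossing (R : realType) (k : nat) : set (R * R) :=
  [set pq | [/\ 0 < pq.1 < 1, 0 < pq.2 < 1
              & branch k pq.1 pq.2 = branch k.+1 pq.1 pq.2]].

Arguments crossing : clear implicits.

(* Main.v *)
Require Import Defs.
From mathcomp Require Import all_boot all_order all_algebra.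
From mathcomp Require Import all_classical all_reals all_analysis.
From mathcomp Require Import complex.
From mathcomp Require Import zify ring lra.

Set Implicit Arguments.
Unset Strict Implicit.
Unset Printing Implicit Defensive.

Import Order.TTheory GRing.Theory Num.Theory.
Import numFieldNormedType.Exports.

Local Open Scope classical_set_scope.
Local Open Scope ring_scope.

(* The marked steps cut a Dyck path of height h into gaps, and the gaps at level k
   are the walks from k to k in the path graph {0, ..., k} counted by the powers
   of a rescaled A_(k+1)(q^2/p^2).  Their generating function therefore has radius
   x_k, and G(x) = sum_h x^h q^(h^2) F_h(x) prod_(k < h) F_k(x)^2; below min x_k the
   F_k are uniformly bounded and the factor q^(h^2) makes the sum converge, while
   the paths U^k g D^k show that the radius is at most each x_k.

   That the active set changes only at neighbouring crossings amounts to
   log-concavity of k |-> Lambda_k(r).  More generally the largest eigenvalue of a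
   weighted path is log-submodular on intervals: swapping two walks where they
   leave the intersection turns a pair of closed walks in I u J and I n J into a
   pair in I and J, and the inequality follows from the growth rates. *)

(** * Walks on a path and their exponential growth *)

(** Everything rests on inequalities up to constant factors, since both a radius of convergence and
    the order of two eigenvalues only see exponential growth. Eigenvalues therefore enter through
    positive eigenvectors, whose multiples are carried along by the step recursion and so enclose
    the walk counts; the same positivity identifies the eigenvalue with the spectral radius.
    Likewise, each comparison with Dyck paths only uses an injection. One obstacle is that a path
    graph is bipartite: walks with a prescribed end vanish for every other length, so lower bounds
    have to pool several consecutive lengths. The exponent [h^2] collects the marked steps, as [U_k]
    and [D_k] start at heights [k - 1] and [k]. The minimum over infinitely many branches is
    attained because, for [q <= p], all edge weights are at most 1 and the branches grow at least
    like [p^-k]; reading the path graph backwards inverts [r], which gives the other case and the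
    symmetry of the curves. *)

Fixpoint walk (R : realType) (up dn : nat -> R) (lo hi : nat) (g : nat -> R)
    (n i : nat) : R :=
  if (lo <= i <= hi)%N then
    if n is n'.+1 then
      up i * walk up dn lo hi g n' i.+1 + dn i * walk up dn lo hi g n' i.-1
    else g i
  else 0.

(** Prescribing zeros outside the interval lets the equation at both endpoints have the same form as
    inside. In every use [lo] is positive, so that 0 is an outside position and the truncated [i.-1]
    does no harm. *)
Definition eigenpair (R : realType) (up dn : nat -> R) (lo hi : nat) (lam : R)
    (v : nat -> R) : Prop :=
  [/\ forall i, (lo <= i <= hi)%N -> 0 < v i,
      forall i, ~~ (lo <= i <= hi)%N -> v i = 0
    & forall i, (lo <= i <= hi)%N -> up i * v i.+1 + dn i * v i.-1 = lam * v i].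

(* The vertex [i] is joined to [i.+1] by an edge of weight [a i]. *)
Definition jacobi_eigenpair (R : realType) (a : nat -> R) (lo hi : nat) (lam : R)
    (v : nat -> R) : Prop :=
  eigenpair a (fun i => a i.-1) lo hi lam v.

Lemma walk_out (R : realType) (up dn : nat -> R) lo hi g n i :
  ~~ (lo <= i <= hi)%N -> walk up dn lo hi g n i = 0.
Proof. by case: n => [|n] /=; move=> /negbTE ->. Qed.

Lemma walkS (R : realType) (up dn : nat -> R) lo hi g n i :
  (lo <= i <= hi)%N ->
  walk up dn lo hi g n.+1 i =
  up i * walk up dn lo hi g n i.+1 + dn i * walk up dn lo hi g n i.-1.
Proof. by move=> /= ->. Qed.

Lemma walk_ge0 (R : realType) (up dn : nat -> R) lo hi g n i :
  (forall i, 0 <= up i) -> (forall i, 0 <= dn i) -> (forall i, 0 <= g i) ->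
  0 <= walk up dn lo hi g n i.
Proof.
move=> u0 d0 g0; elim: n i => [|n IH] i /=; first by case: ifP.
by case: ifP => // _; rewrite addr_ge0// mulr_ge0.
Qed.

(** The recursion reproduces a multiple of [v] with the extra factor [lam], and its coefficients are
    nonnegative, so a comparison with [v] at length 0 propagates to all lengths. Together with
    [walk_ge] this makes [lam] the growth rate of the walks. *)
Lemma walk_le (R : realType) (up dn : nat -> R) lo hi g lam v C :
  (forall i, 0 <= up i) -> (forall i, 0 <= dn i) ->
  eigenpair up dn lo hi lam v ->
  (forall i, (lo <= i <= hi)%N -> g i <= C * v i) ->
  forall n i, walk up dn lo hi g n i <= C * lam ^+ n * v i.
Proof.
move=> u0 d0 [vp vz ve] gC; elim=> [|n IH] i.
  rewrite expr0 mulr1 /=; case: ifP => [|/negbT] H; first exact: gC.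
  by rewrite vz// mulr0.
case: (boolP (lo <= i <= hi)%N) => H; last by rewrite walk_out// vz// mulr0.
rewrite walkS//.
have -> : C * lam ^+ n.+1 * v i =
  up i * (C * lam ^+ n * v i.+1) + dn i * (C * lam ^+ n * v i.-1).
  rewrite exprSr [in LHS](mulrA C) -mulrA -ve//; ring.
by rewrite lerD// ler_wpM2l.
Qed.

Lemma walk_ge (R : realType) (up dn : nat -> R) lo hi g lam v c :
  (forall i, 0 <= up i) -> (forall i, 0 <= dn i) ->
  eigenpair up dn lo hi lam v ->
  (forall i, (lo <= i <= hi)%N -> c * v i <= g i) ->
  forall n i, c * lam ^+ n * v i <= walk up dn lo hi g n i.
Proof.
move=> u0 d0 [vp vz ve] gC; elim=> [|n IH] i.
  rewrite expr0 mulr1 /=; case: ifP => [|/negbT] H; first exact: gC.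
  by rewrite vz// mulr0.
case: (boolP (lo <= i <= hi)%N) => H; last by rewrite walk_out// vz// mulr0.
rewrite walkS//.
have -> : c * lam ^+ n.+1 * v i =
  up i * (c * lam ^+ n * v i.+1) + dn i * (c * lam ^+ n * v i.-1).
  rewrite exprSr [in LHS](mulrA c) -mulrA -ve//; ring.
by rewrite lerD// ler_wpM2l.
Qed.

Lemma eigenvalue_ge0 (R : realType) (up dn : nat -> R) lo hi lam v :
  (forall i, 0 <= up i) -> (forall i, 0 <= dn i) -> (lo <= hi)%N ->
  eigenpair up dn lo hi lam v -> 0 <= lam.
Proof.
move=> u0 d0 lh [vp vz ve].
have vn i : 0 <= v i by case: (boolP (lo <= i <= hi)%N) => [/vp/ltW|/vz->].
have H : (lo <= lo <= hi)%N by rewrite leqnn.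
by rewrite -(pmulr_lge0 _ (vp _ H)) -ve// addr_ge0// mulr_ge0.
Qed.

Lemma eigenvalue_gt0 (R : realType) (up dn : nat -> R) lo hi lam v :
  (forall i, 0 < up i) -> (forall i, 0 <= dn i) -> (lo < hi)%N ->
  eigenpair up dn lo hi lam v -> 0 < lam.
Proof.
move=> u0 d0 lh [vp vz ve].
have vn i : 0 <= v i by case: (boolP (lo <= i <= hi)%N) => [/vp/ltW|/vz->].
have H : (lo <= lo <= hi)%N by rewrite leqnn ltnW.
rewrite -(pmulr_lgt0 _ (vp _ H)) -ve// ltr_wpDr ?mulr_ge0// mulr_gt0//.
by apply: vp; rewrite leqnSn.
Qed.

Lemma pos_bounds (R : realType) (w v : nat -> R) lo hi :
  (forall i, (lo <= i <= hi)%N -> 0 < v i) ->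
  (forall i, (lo <= i <= hi)%N -> 0 < w i) ->
  exists2 C, 0 < C & forall i, (lo <= i <= hi)%N -> w i <= C * v i.
Proof.
(* The sum of the ratios bounds each of them; the added 1 keeps the constant positive even on an
   empty interval. *)
move=> vp wp; exists (1 + \sum_(lo <= i < hi.+1) w i / v i).
  rewrite ltr_pwDl// big_nat sumr_ge0// => i H.
  by rewrite ltW// divr_gt0 ?vp ?wp.
move=> i H; rewrite -ler_pdivrMr ?vp//.
rewrite (big_cat_nat (n := i)) /=; [|lia|lia].
rewrite (big_nat_recl hi i) /=; last lia.
have S1 : 0 <= \sum_(lo <= j < i) w j / v j.
  by rewrite big_nat sumr_ge0// => j J; rewrite ltW// divr_gt0 ?vp ?wp//; lia.
have S2 : 0 <= \sum_(i <= j < hi) w j.+1 / v j.+1.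
  by rewrite big_nat sumr_ge0// => j J; rewrite ltW// divr_gt0 ?vp ?wp//; lia.
lra.
Qed.

Lemma bounded_powers (R : realType) (y C : R) :
  (forall n, y ^+ n <= C) -> y <= 1.
Proof.
move=> H; rewrite leNgt; apply/negP => y1.
have y0 : 0 < y - 1 by rewrite subr_gt0.
have bern n : 1 + n%:R * (y - 1) <= y ^+ n.
  elim: n => [|n IH]; first by rewrite mul0r addr0 expr0.
  rewrite exprS; apply: (@le_trans _ _ (y * (1 + n%:R * (y - 1)))).
    have n0 : (0 : R) <= n%:R by [].
    rewrite -subr_ge0; apply: (le_trans (mulr_ge0 n0 (sqr_ge0 (y - 1)))).
    by rewrite le_eqVlt; apply/orP; left; apply/eqP; rewrite -natr1; ring.
  by rewrite ler_wpM2l//; lra.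
have [n Hn] : exists n : nat, C / (y - 1) < n%:R.
  exists (Num.bound (C / (y - 1))).
  apply: archi_boundP; apply: divr_ge0 (ltW y0).
  by have := H 0%N; rewrite expr0; apply: le_trans.
move: Hn; rewrite ltr_pdivrMr// => Hn.
have := bern n; have := H n; lra.
Qed.

(** This is how growth rates are compared when both sides are known only up to constant factors. *)
Lemma bounded_powers2 (R : realType) (y z c C : R) : 0 < c -> 0 <= y -> 0 < z ->
  (forall n, c * y ^+ n <= C * z ^+ n) -> y <= z.
Proof.
move=> c0 y0 z0 H; rewrite -[z]mul1r -ler_pdivrMr//.
apply: (@bounded_powers _ _ (C / c)) => n.
by rewrite expr_div_n ler_pdivrMr ?exprn_gt0// mulrAC ler_pdivlMr// mulrC.
Qed.

(** * Submodularity of the largest eigenvalue *)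

(* Two walks of the same parity cannot cross without meeting.  Given a walk in
   the union [1, m.+2] and one in the intersection [2, m.+1], exchanging them on
   the stretches where the first leaves [1, m.+1] produces a walk in [1, m.+1]
   and one in [2, m.+2] with the same total weight; the three inequalities are
   the corresponding counts, made inductive in the length. *)
Lemma walk_swap (R : realType) (a : nat -> R) (m : nat) :
  (forall i, 0 <= a i) ->
  let W lo hi := walk a (fun i => a i.-1) lo hi (fun=> 1) in
  let u := W 1%N m.+1 in let w := W 2%N m.+2 in
  let f := W 1%N m.+2 in let g := W 2%N m.+1 in
  forall n x d, let y := (x + d.*2)%N in
  [/\ f n x * g n y <= u n x * w n y,
      f n y * g n x <= u n x * w n y
    & f n x * g n y + f n y * g n x <= u n x * w n y + u n y * w n x].
Proof.
move=> a0 W u w f g.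
have W0 lo hi n i : 0 <= W lo hi n i by apply: walk_ge0.
have out lo hi n i : ~~ (lo <= i <= hi)%N -> W lo hi n i = 0 by apply: walk_out.
have WS lo hi n i : (lo <= i <= hi)%N ->
    W lo hi n.+1 i = a i * W lo hi n i.+1 + a i.-1 * W lo hi n i.-1.
  exact: walkS.
pose T n x y :=
  [/\ f n x * g n y <= u n x * w n y, f n y * g n x <= u n x * w n y
    & f n x * g n y + f n y * g n x <= u n x * w n y + u n y * w n x].
(* Outside of [2, m.+1] one of the products on the left vanishes, so only
   positions where the recursion holds for all four functions matter. *)
have reduce n x y : (x <= y)%N ->
    ((2 <= x)%N -> (y <= m.+1)%N -> T n x y) ->
    ((1 <= x)%N -> (2 <= y)%N -> (y <= m.+1)%N -> f n x * g n y <= u n x * w n y) ->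
    ((2 <= x)%N -> (x <= m.+1)%N -> (y <= m.+2)%N -> f n y * g n x <= u n x * w n y) ->
    T n x y.
  move=> xy Hin HD HD'.
  have D : f n x * g n y <= u n x * w n y.
    case: (boolP (2 <= y <= m.+1)%N) => [/andP[y2 ym]|yo]; last first.
      by rewrite /g (out _ _ _ _ yo) mulr0 mulr_ge0 ?W0.
    case: (ltnP 0 x) => x0; first exact: HD.
    by rewrite /f out ?mul0r ?mulr_ge0 ?W0//; lia.
  have D' : f n y * g n x <= u n x * w n y.
    case: (boolP (2 <= x <= m.+1)%N) => [/andP[x2 xm]|xo]; last first.
      by rewrite /g (out _ _ _ _ xo) mulr0 mulr_ge0 ?W0.
    case: (leqP y m.+2) => ym; first exact: HD'.
    by rewrite /f out ?mul0r ?mulr_ge0 ?W0//; lia.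
  split=> //.
  have uw : 0 <= u n y * w n x by rewrite mulr_ge0 ?W0.
  case: (leqP 2 x) => x2; last first.
    have -> : g n x = 0 by rewrite /g out//; lia.
    by rewrite mulr0 addr0 ler_wpDr.
  case: (leqP y m.+1) => ym; first by have [] := Hin x2 ym.
  have -> : g n y = 0 by rewrite /g out//; lia.
  by rewrite mulr0 add0r ler_wpDr.
elim=> [|n IH] x d y.
  have E lo hi i : W lo hi 0%N i = (lo <= i <= hi)%N%:R by rewrite /W /=; case: ifP.
  have xy : (x <= y)%N by rewrite leq_addr.
  apply: reduce => //.
  - move=> x2 ym; rewrite /T /u /w /f /g !E.
    have -> : (1 <= x <= m.+1)%N by lia.
    have -> : (2 <= x <= m.+1)%N by lia.
    have -> : (1 <= x <= m.+2)%N by lia.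
    have -> : (2 <= x <= m.+2)%N by lia.
    have -> : (1 <= y <= m.+1)%N by lia.
    have -> : (2 <= y <= m.+1)%N by lia.
    have -> : (1 <= y <= m.+2)%N by lia.
    have -> : (2 <= y <= m.+2)%N by lia.
    by [].
  - move=> x1 y2 ym; rewrite /u /w /f /g !E.
    have -> : (1 <= x <= m.+1)%N by lia.
    have -> : (1 <= x <= m.+2)%N by lia.
    have -> : (2 <= y <= m.+1)%N by lia.
    have -> : (2 <= y <= m.+2)%N by lia.
    by [].
  - move=> x2 xm ym; rewrite /u /w /f /g !E.
    have -> : (1 <= x <= m.+1)%N by lia.
    have -> : (2 <= x <= m.+1)%N by lia.
    have -> : (1 <= y <= m.+2)%N by lia.
    have -> : (2 <= y <= m.+2)%N by lia.
    by [].
have IH' x' y' e : (y' = x' + e.*2)%N -> T n x' y'.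
  by move=> ->; apply: IH.
have xy : (x <= y)%N by rewrite leq_addr.
have aa i j : 0 <= a i * a j by rewrite mulr_ge0.
apply: reduce => //.
- move=> x2 ym; rewrite /T /u /w /f /g !WS; try lia.
  rewrite -/f -/g -/u -/w.
  have [A1 B1 C1] := IH' x.+1 y.+1 d ltac:(rewrite /y; lia).
  have [A2 B2 C2] := IH' x.-1 y.-1 d ltac:(rewrite /y; lia).
  have [A4 B4 C4] := IH' x.-1 y.+1 d.+1 ltac:(rewrite /y; lia).
  (* From a common vertex, the step pairs to [(x.+1, x.-1)] and [(x.-1, x.+1)] are the same pair
     with the walks exchanged. Only the sum of the two terms can be bounded, which is what the third
     inequality is for. *)
  case: d => [|d] in y xy ym A1 B1 C1 A2 B2 C2 A4 B4 C4 *.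
    have E : y = x by rewrite /y; lia.
    rewrite E in A1 B1 C1 A2 B2 C2 A4 B4 C4 *.
    have := ler_wpM2l (aa x x) A1; have := ler_wpM2l (aa x.-1 x.-1) A2.
    have := ler_wpM2l (aa x x.-1) C4.
    by move=> *; split; lra.
  have [A3 B3 C3] := IH' x.+1 y.-1 d ltac:(rewrite /y; lia).
  have := (ler_wpM2l (aa x y) A1, ler_wpM2l (aa x.-1 y.-1) A2,
    ler_wpM2l (aa x y.-1) A3, ler_wpM2l (aa x.-1 y) A4).
  have := (ler_wpM2l (aa x y) B1, ler_wpM2l (aa x.-1 y.-1) B2,
    ler_wpM2l (aa x y.-1) B3, ler_wpM2l (aa x.-1 y) B4).
  have := (ler_wpM2l (aa x y) C1, ler_wpM2l (aa x.-1 y.-1) C2,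
    ler_wpM2l (aa x y.-1) C3, ler_wpM2l (aa x.-1 y) C4).
  by move=> [[[? ?] ?] ?] [[[? ?] ?] ?] [[[? ?] ?] ?]; split; lra.
- move=> x2 y2 ym; rewrite /u /w /f /g !WS; try lia.
  rewrite -/f -/g -/u -/w.
  have [A1 B1 C1] := IH' x.+1 y.+1 d ltac:(rewrite /y; lia).
  have [A2 B2 C2] := IH' x.-1 y.-1 d ltac:(rewrite /y; lia).
  have [A4 B4 C4] := IH' x.-1 y.+1 d.+1 ltac:(rewrite /y; lia).
  case: d => [|d] in y xy y2 ym A1 B1 C1 A2 B2 C2 A4 B4 C4 *.
    have E : y = x by rewrite /y; lia.
    rewrite E in A1 B1 C1 A2 B2 C2 A4 B4 C4 *.
    have := ler_wpM2l (aa x x) A1; have := ler_wpM2l (aa x.-1 x.-1) A2.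
    have := ler_wpM2l (aa x x.-1) C4.
    by move=> *; lra.
  have [A3 B3 C3] := IH' x.+1 y.-1 d ltac:(rewrite /y; lia).
  have := (ler_wpM2l (aa x y) A1, ler_wpM2l (aa x.-1 y.-1) A2,
    ler_wpM2l (aa x y.-1) A3, ler_wpM2l (aa x.-1 y) A4).
  by move=> [[[? ?] ?] ?]; lra.
- move=> x2 xm ym; rewrite /u /w /f /g !WS; try lia.
  rewrite -/f -/g -/u -/w.
  have [A1 B1 C1] := IH' x.+1 y.+1 d ltac:(rewrite /y; lia).
  have [A2 B2 C2] := IH' x.-1 y.-1 d ltac:(rewrite /y; lia).
  have [A4 B4 C4] := IH' x.-1 y.+1 d.+1 ltac:(rewrite /y; lia).
  case: d => [|d] in y xy ym A1 B1 C1 A2 B2 C2 A4 B4 C4 *.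
    have E : y = x by rewrite /y; lia.
    rewrite E in A1 B1 C1 A2 B2 C2 A4 B4 C4 *.
    have := ler_wpM2l (aa x x) A1; have := ler_wpM2l (aa x.-1 x.-1) A2.
    have := ler_wpM2l (aa x x.-1) C4.
    by move=> *; lra.
  have [A3 B3 C3] := IH' x.+1 y.-1 d ltac:(rewrite /y; lia).
  have := (ler_wpM2l (aa x y) B1, ler_wpM2l (aa x.-1 y.-1) B2,
    ler_wpM2l (aa x y.-1) B3, ler_wpM2l (aa x.-1 y) B4).
  by move=> [[[? ?] ?] ?]; lra.
Qed.

Lemma eigenvalue_submodular (R : realType) (a : nat -> R) (m : nat)
    (lI lJ lU lN : R) (vI vJ vU vN : nat -> R) :
  (forall i, 0 < a i) -> (0 < m)%N ->
  jacobi_eigenpair a 1 m.+1 lI vI -> jacobi_eigenpair a 2 m.+2 lJ vJ ->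
  jacobi_eigenpair a 1 m.+2 lU vU -> jacobi_eigenpair a 2 m.+1 lN vN ->
  lU * lN <= lI * lJ.
Proof.
move=> ap m0 HI HJ HU HN.
have a0 i : 0 <= a i by exact: ltW.
have gt0 lo hi l v : (lo < hi)%N -> jacobi_eigenpair a lo hi l v -> 0 < l.
  by move=> lh; apply: eigenvalue_gt0 => //.
have ge0 lo hi l v : (lo <= hi)%N -> jacobi_eigenpair a lo hi l v -> 0 <= l.
  by move=> lh; apply: eigenvalue_ge0 => //.
have pos lo hi l v : jacobi_eigenpair a lo hi l v -> forall i, (lo <= i <= hi)%N -> 0 < v i.
  by case.
have up lo hi l v : jacobi_eigenpair a lo hi l v -> exists2 C, 0 < C &
    forall n, walk a (fun i => a i.-1) lo hi (fun=> 1) n 2 <= C * l ^+ n * v 2%N.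
  move=> H; have [C C0 HC] := pos_bounds (w := fun=> 1) (pos _ _ _ _ H) (fun _ _ => ltr01).
  by exists C => // n; apply: (walk_le _ _ H).
have dnb lo hi l v : jacobi_eigenpair a lo hi l v -> exists2 c, 0 < c &
    forall n, c * l ^+ n * v 2%N <= walk a (fun i => a i.-1) lo hi (fun=> 1) n 2.
  move=> H; have [C C0 HC] := pos_bounds (v := fun=> 1) (fun _ _ => ltr01) (pos _ _ _ _ H).
  exists C^-1 => [|n]; first by rewrite invr_gt0.
  by apply: (walk_ge _ _ H) => // i /HC; rewrite mulr1 ler_pdivrMl// mulr1.
have [CI CI0 BI] := up _ _ _ _ HI; have [CJ CJ0 BJ] := up _ _ _ _ HJ.
have [cU cU0 BU] := dnb _ _ _ _ HU; have [cN cN0 BN] := dnb _ _ _ _ HN.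
have pI : 0 < vI 2%N by apply: (pos _ _ _ _ HI); lia.
have pJ : 0 < vJ 2%N by apply: (pos _ _ _ _ HJ); lia.
have pU : 0 < vU 2%N by apply: (pos _ _ _ _ HU); lia.
have pN : 0 < vN 2%N by apply: (pos _ _ _ _ HN); lia.
have lI0 : 0 < lI by apply: gt0 HI.
have lJ0 : 0 < lJ by apply: gt0 HJ.
have lU0 : 0 <= lU by apply: ge0 HU.
have lN0 : 0 <= lN by apply: ge0 HN.
apply: (@bounded_powers2 _ _ _ (cU * vU 2%N * (cN * vN 2%N))
  (CI * vI 2%N * (CJ * vJ 2%N))); rewrite ?mulr_gt0 ?mulr_ge0// => n.
(* Both walks start at vertex 2, which lies in all four intervals because [m] is positive. *)
have [H _ _] := walk_swap m a0 n 2 0.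
rewrite addn0 in H.
apply: (@le_trans _ _ ((cU * lU ^+ n * vU 2%N) * (cN * lN ^+ n * vN 2%N))).
  by rewrite le_eqVlt exprMn; apply/orP; left; apply/eqP; ring.
apply: (@le_trans _ _ ((CI * lI ^+ n * vI 2%N) * (CJ * lJ ^+ n * vJ 2%N))); last first.
  by rewrite le_eqVlt exprMn; apply/orP; left; apply/eqP; ring.
apply: (le_trans (ler_pM _ _ (BU n) (BN n))).
- by rewrite !mulr_ge0 ?exprn_ge0// ltW.
- by rewrite !mulr_ge0 ?exprn_ge0// ltW.
apply: (le_trans H); apply: ler_pM (BI n) (BJ n).
- by apply: walk_ge0.
- by apply: walk_ge0.
Qed.

(** * Positive eigenvectors and the spectral radius *)

(* The solution of the eigenvector recursion with initial values 0, 1: up to a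
   factor, [jacobi a x i.+1] is the characteristic polynomial of the first [i]
   vertices. *)
Fixpoint jacobi (R : realType) (a : nat -> R) (x : R) (i : nat) : R :=
  match i with
  | 0 => 0
  | i'.+1 => match i' with
             | 0 => 1
             | j.+1 => (x * jacobi a x i' - a j * jacobi a x j) / a i'
             end
  end.

Lemma jacobiSS (R : realType) (a : nat -> R) x i :
  jacobi a x i.+2 = (x * jacobi a x i.+1 - a i * jacobi a x i) / a i.+1.
Proof. by []. Qed.

Lemma continuous_jacobi (R : realType) (a : nat -> R) i :
  continuous (fun x => jacobi a x i).
Proof.
suff H : continuous (fun x => jacobi a x i) /\ continuous (fun x => jacobi a x i.+1).
  by case: H.
elim: i => [|i [IH0 IH1]]; first by split=> x; exact: cvg_cst.
split=> // x; under eq_fun do rewrite jacobiSS.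
apply: cvgM; last exact: cvg_cst.
apply: cvgB; apply: cvgM; [exact: cvg_id|exact: IH1|exact: cvg_cst|exact: IH0].
Qed.

Lemma jacobi_large (R : realType) (a : nat -> R) N : (forall i, 0 < a i) ->
  exists B, forall x, B <= x -> forall i, (i <= N)%N -> 0 < jacobi a x i.+1.
Proof.
(* As soon as [x >= a i + a i.+1], the recursion keeps the sequence nondecreasing; the sum of all
   weights is a crude bound serving every [i] at once. *)
move=> ap; exists (\sum_(i < N.+1) (a i)) => x Bx.
suff H i : (i <= N)%N -> 0 <= jacobi a x i <= jacobi a x i.+1 /\ 0 < jacobi a x i.+1.
  by move=> i /H [].
elim: i => [|i IH] iN; first by rewrite /= lexx ler01 ltr01.
have [/andP[J0 J1] Jp] := IH (ltnW iN).
have aB : a i + a i.+1 <= x.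
  apply: le_trans Bx; rewrite -(big_mkord xpredT).
  rewrite (big_cat_nat (n := i)) /=; [|lia|lia].
  rewrite (@big_ltn _ _ _ i); last lia.
  rewrite (@big_ltn _ _ _ i.+1); last lia.
  have S1 : 0 <= \sum_(0 <= j < i) a j by rewrite sumr_ge0// => j _; exact: ltW.
  have S2 : 0 <= \sum_(i.+2 <= j < N.+1) a j by rewrite sumr_ge0// => j _; exact: ltW.
  lra.
have key : jacobi a x i.+1 <= jacobi a x i.+2.
  rewrite jacobiSS ler_pdivlMr//.
  have h1 := ler_wpM2l (ltW (ap i)) J1.
  have h2 : (a i + a i.+1) * jacobi a x i.+1 <= x * jacobi a x i.+1.
    by rewrite ler_wpM2r// ltW.
  lra.
by rewrite key (ltW Jp) (lt_le_trans Jp).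
Qed.

(** [lam] is the largest zero. Largest zeros strictly increase with the index: at the largest zero
    of one polynomial the recursion makes the next one negative, whereas it is positive for large
    arguments. Hence all earlier polynomials are still positive from [lam] on. *)
Lemma jacobi_root (R : realType) (a : nat -> R) h : (forall i, 0 < a i) ->
  exists lam : R, [/\ jacobi a lam h.+2 = 0,
    forall x, lam <= x -> forall i, (i <= h)%N -> 0 < jacobi a x i.+1
  & forall x, lam < x -> 0 < jacobi a x h.+2].
Proof.
move=> ap; elim: h => [|h [l [l0 lp lg]]].
  exists 0; split=> [|x _ [|i] //|x x0]; rewrite ?jacobiSS /=.
    by rewrite mulr1 mulr0 subr0 mul0r.
  by rewrite mulr1 mulr0 subr0 divr_gt0.
pose f x := jacobi a x h.+3.
have [B HB] := jacobi_large h.+2 ap.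
have fl : f l < 0.
  rewrite /f jacobiSS l0 mulr0 sub0r mulNr oppr_lt0 divr_gt0// mulr_gt0//.
  exact: lp.
pose Z : set R := [set x | f x <= 0].
have Zl : Z l by exact: ltW.
have Zub : ubound Z B.
  move=> x Zx; rewrite leNgt; apply/negP => Bx.
  by have := HB x (ltW Bx) h.+2 (leqnn _); rewrite ltNge; move/negP; apply.
have supZ : has_sup Z by split; [exists l | exists B].
have cf : continuous f by exact: continuous_jacobi.
have Zcl : closed Z.
  have -> : Z = f @^-1` [set y | y <= 0] by [].
  by apply: (proj1 (continuous_closedP _) cf); exact: closed_le.
have Zs : Z (sup Z).
  have := closure_sup (proj1 supZ) (proj2 supZ).
  by rewrite -(proj1 (closure_id Z) Zcl).
have sB : sup Z <= B by apply: ge_sup => //; exact: (proj1 supZ).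
have sub x : Z x -> x <= sup Z by exact: sup_upper_bound.
have s0 : f (sup Z) = 0.
  have fB : 0 < f B by apply: HB (lexx _) _ (leqnn _).
  have [||c] := @IVT R f (sup Z) B 0 sB.
  - exact: continuous_subspaceT.
  - have Zs' : f (sup Z) <= 0 by exact: Zs.
    by rewrite ge_min Zs' /= le_max (ltW fB) orbT.
  rewrite in_itv/= => /andP[sc cB] fc.
  have cs : c <= sup Z by apply: sub; rewrite /Z /= fc.
  by rewrite -fc; congr f; apply/eqP; rewrite eq_le sc cs.
have ls : l < sup Z.
  rewrite lt_neqAle sub// andbT; apply/eqP => E.
  by move: fl; rewrite E s0 ltxx.
exists (sup Z); split=> // [x sx i|x sx].
  rewrite leq_eqVlt => /orP[/eqP->|ih].
    by apply: lg; apply: lt_le_trans sx.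
  by apply: lp => //; apply/ltW/(lt_le_trans ls).
rewrite ltNge; apply/negP => Zx; have := sub x Zx.
by rewrite leNgt sx.
Qed.

Lemma jacobi_eigenpair_exists (R : realType) (a : nat -> R) h : (forall i, 0 < a i) ->
  exists lam v, jacobi_eigenpair a 1 h.+1 lam v.
Proof.
move=> ap; have [l [l0 lp _]] := jacobi_root h ap.
exists l, (fun i => if (1 <= i <= h.+1)%N then jacobi a l i else 0); split.
- by move=> [//|i] H; rewrite H; apply: lp => //; lia.
- by move=> i /negbTE ->.
move=> [//|i] H; rewrite H /=.
(* Truncating the sequence to the interval is consistent with the recursion: the first value cut off
   is [jacobi a l h.+2], which is zero by the choice of [l]. *)
have -> : (if (0 < i.+2 <= h.+1)%N then jacobi a l i.+2 else 0) = jacobi a l i.+2.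
  by case: ifP => // /negbT Hn; have -> : i = h by lia.
have -> : (if (0 < i <= h.+1)%N then jacobi a l i else 0) = jacobi a l i.
  case: ifP => // /negbT Hn; have -> : i = 0%N by lia.
  by [].
rewrite jacobiSS mulrCA divff ?gt_eqF// mulr1 subrK; exact: erefl.
Qed.

(** The scaling is asked from [lo] on because the weights [s ^+ i.-1] violate it at 0, where
    truncation gives [a 0 = a 1]. The edge that enters the interval from below meets a zero of
    [v]. *)
Lemma jacobi_eigenpair_shift (R : realType) (a : nat -> R) (c : R) lo hi lam v : (0 < lo)%N ->
  (forall i, (lo <= i)%N -> a i.+1 = c * a i) ->
  jacobi_eigenpair a lo hi lam v ->
  jacobi_eigenpair a lo.+1 hi.+1 (c * lam) (fun i => v i.-1).
Proof.
move=> lo0 ac [vp vz ve]; split.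
- by move=> i H; apply: vp; lia.
- move=> [|i] H; last by apply: vz; lia.
  by apply: vz; lia.
move=> [//|[|i]] H; first by lia.
rewrite /= -mulrA -(ve i.+1); last by lia.
rewrite ac; last by lia.
case: (leqP lo i) => [loi|ilo].
  rewrite (_ : a i.+1 = c * a i); last by apply: ac; lia.
  rewrite /=; ring.
by rewrite /= (vz i) ?mulr0 ?addr0 ?mulrA//; lia.
Qed.

(** Reading the path backwards sends the vertex [i] to [h.+2 - i], hence the edge [i] to the edge
    [h.+1 - i]. *)
Lemma jacobi_eigenpair_rev (R : realType) (a b : nat -> R) (c : R) h lam v :
  (forall i, (0 < i <= h)%N -> b i = c * a (h.+1 - i)%N) ->
  jacobi_eigenpair a 1 h.+1 lam v ->
  jacobi_eigenpair b 1 h.+1 (c * lam) (fun i => if i is 0 then 0 else v (h.+2 - i)%N).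
Proof.
move=> bc [vp vz ve]; split.
- by move=> [//|i] H; apply: vp; lia.
- by move=> [//|i] H; apply: vz; lia.
move=> [//|i] H; rewrite -mulrA -ve; last by lia.
have E1 : b i.+1 * v (h.+2 - i.+2)%N = c * (a (h.+2 - i.+1).-1 * v (h.+2 - i.+1).-1).
  case: (ltnP i h) => ih.
    by rewrite bc ?mulrA//; congr (_ * a _ * v _); lia.
  by rewrite !vz ?mulr0//; lia.
have E2 : b i * (if i is 0 then 0 else v (h.+2 - i)%N) =
    c * (a (h.+2 - i.+1)%N * v (h.+2 - i.+1).+1).
  case: i H {E1} => [|i] H; first by rewrite (vz (_.+1)) ?mulr0//; lia.
  by rewrite bc ?mulrA; [congr (_ * a _ * v _); lia|lia].
by rewrite E1 /= E2 mulrDr addrC.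
Qed.

(** Add up the eigenvalue equations over all vertices: each entry of [v] occurs at most twice on the
    left, with coefficients at most [M]. *)
Lemma eigenvalue_le (R : realType) (a : nat -> R) (M : R) h lam v :
  (forall i, 0 < a i) -> (forall i, (0 < i <= h)%N -> a i <= M) -> 0 <= M ->
  jacobi_eigenpair a 1 h.+1 lam v -> lam <= 2 * M.
Proof.
move=> ap aM M0 [vp vz ve].
have v0 i : 0 <= v i by case: (boolP (1 <= i <= h.+1)%N) => [/vp/ltW|/vz->].
have S0 : 0 < \sum_(1 <= i < h.+2) v i.
  by rewrite big_ltn// ltr_wpDr ?vp// sumr_ge0.
rewrite -(ler_pM2r S0) mulr_sumr.
rewrite (eq_big_nat _ _ (F2 := fun i => a i * v i.+1 + a i.-1 * v i.-1)); last first.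
  by move=> i H; rewrite -ve//; lia.
rewrite big_split /=.
have A : \sum_(1 <= i < h.+2) a i * v i.+1 <= M * \sum_(1 <= i < h.+2) v i.
  rewrite big_nat_recr//= [X in _ + a _ * X]vz ?mulr0 ?addr0; last by lia.
  rewrite [in leRHS]big_ltn// [in leRHS]big_add1 /= mulrDr mulr_sumr ler_wpDl ?mulr_ge0//.
  rewrite big_nat [leRHS]big_nat; apply: ler_sum => i H.
  by rewrite ler_wpM2r// aM//; lia.
have B : \sum_(1 <= i < h.+2) a i.-1 * v i.-1 <= M * \sum_(1 <= i < h.+2) v i.
  rewrite big_add1 /= big_ltn// [X in a _ * X]vz// mulr0 add0r.
  rewrite [in leRHS]big_nat_recr//= mulrDr mulr_sumr ler_wpDr ?mulr_ge0//.
  rewrite big_nat [leRHS]big_nat; apply: ler_sum => i H.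
  by rewrite ler_wpM2r// aM//; lia.
by apply: le_trans (lerD A B) _; rewrite -mulrA mulr_natl mulr2n.
Qed.

Lemma normc_sum (R : realType) (I : finType) (F : I -> R[i]) :
  ComplexField.Normc.normc (\sum_i F i) <= \sum_i ComplexField.Normc.normc (F i).
Proof.
elim/big_ind2: _ => [|x1 x2 y1 y2 h1 h2|//]; first by rewrite ComplexField.Normc.normc0.
by apply: le_trans (le_normcD _ _) _; rewrite lerD.
Qed.

Lemma normc_real (R : realType) (x : R) : ComplexField.Normc.normc (real_complex R x) = `|x|.
Proof. by rewrite /ComplexField.Normc.normc /= expr0n /= addr0 sqrtr_sqr. Qed.

Lemma spectral_radius_eigenpair (R : realType) (n : nat) (A : 'M[R]_n.+1)
    (lam : R) (v : 'I_n.+1 -> R) :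
  (forall i j, 0 <= A i j) -> A^T = A -> (forall i, 0 < v i) ->
  (forall i, \sum_j A i j * v j = lam * v i) -> spectral_radius A = lam.
Proof.
move=> A0 At vp ve.
have sym i j : A i j = A j i by rewrite -{1}At mxE.
have l0 : 0 <= lam.
  rewrite -(pmulr_lge0 _ (vp ord0)) -ve; apply: sumr_ge0 => j _.
  by rewrite mulr_ge0// ltW.
rewrite /spectral_radius; set S := [set _ | _ in _].
have Sl : S lam.
  exists (real_complex R lam); last by rewrite normc_real ger0_norm.
  (* [eigenvalue] concerns row vectors; symmetry of [A] turns the column eigenvector [v] into a row
     one. *)
  apply/eigenvalueP; exists (\row_i real_complex R (v i)).
    apply/rowP => j; rewrite !mxE -rmorphM /= -ve rmorph_sum; apply: eq_bigr => i _.
    by rewrite !mxE -rmorphM mulrC sym.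
  apply/eqP => /rowP/(_ ord0); rewrite !mxE => -[E].
  by have := vp ord0; rewrite E ltxx.
have Sub : ubound S lam.
  move=> _ [z /eigenvalueP[u uz u0] <-].
  pose nu i := ComplexField.Normc.normc (u ord0 i).
  have nu0 i : 0 <= nu i by rewrite /nu /ComplexField.Normc.normc; case: (u _ _) => *; rewrite sqrtr_ge0.
  (* Weighting the entries of [u] with the positive eigenvector gives
     |z| <= lam. *)
  have step j : ComplexField.Normc.normc z * nu j <= \sum_i nu i * A i j.
    rewrite /nu -ComplexField.Normc.normcM.
    have -> : z * u ord0 j = \sum_i u ord0 i * real_complex R (A i j).
      move/rowP: uz => /(_ j); rewrite !mxE => <-.
      by apply: eq_bigr => i _; rewrite mxE.
    apply: le_trans (normc_sum _) _; apply: ler_sum => i _.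
    by rewrite ComplexField.Normc.normcM normc_real ger0_norm.
  have Sp : 0 < \sum_i nu i * v i.
    rewrite lt_neqAle sumr_ge0 ?andbT => [|i _]; last by rewrite mulr_ge0// ltW.
    rewrite eq_sym; apply: contra u0; rewrite psumr_eq0 => [/allP H|i _]; last first.
      by rewrite mulr_ge0// ltW.
    apply/eqP/rowP => i; rewrite mxE; apply: ComplexField.Normc.eq0_normc.
    have := H i (mem_index_enum _); rewrite mulf_eq0 => /orP[/eqP//|/eqP E].
    by have := vp i; rewrite E ltxx.
  rewrite -(ler_pM2r Sp) !mulr_sumr.
  apply: (@le_trans _ _ (\sum_j (\sum_i nu i * A i j) * v j)).
    by apply: ler_sum => j _; rewrite mulrA ler_wpM2r// ltW.
  under eq_bigr do rewrite mulr_suml.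
  rewrite exchange_big /=; apply: ler_sum => i _.
  under eq_bigr do rewrite -mulrA.
  by rewrite -mulr_sumr ve mulrCA.
apply/eqP; rewrite eq_le; apply/andP; split.
  by apply: ge_sup => //; exists lam.
by apply: ub_le_sup => //; exists lam.
Qed.

(** Writing [r] as [s ^+ 2] turns the half-integral real exponents of [Amx] into natural ones. *)
Lemma powR_half (R : realType) (s : R) (n : nat) : 0 < s ->
  (s ^+ 2) `^ (n%:R / 2) = s ^+ n.
Proof.
move=> s0; rewrite -[s ^+ 2]powR_mulrn ?ltW// -powRrM mulrCA mulfV ?pnatr_eq0//.
by rewrite mulr1 powR_mulrn// ltW.
Qed.

Lemma Amx_radius (R : realType) (s : R) h lam v : 0 < s ->
  jacobi_eigenpair (fun i => s ^+ i.-1) 1 h.+1 lam v ->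
  spectral_radius (Amx h.+1 (s ^+ 2)) = lam.
Proof.
move=> s0 [vp vz ve].
have E (i j : 'I_h.+1) : Amx h.+1 (s ^+ 2) i j =
    (if j == i.+1 :> nat then s ^+ i else 0) + (if i == j.+1 :> nat then s ^+ j else 0).
  rewrite mxE !powR_half//; case: eqP => [->|_]; last by rewrite add0r.
  by rewrite ifF ?addr0//; apply/eqP; lia.
apply: (@spectral_radius_eigenpair _ _ _ _ (fun i : 'I_h.+1 => v i.+1)).
- by move=> i j; rewrite E addr_ge0//; case: ifP => // _; rewrite exprn_ge0// ltW.
- by apply/matrixP => i j; rewrite mxE !E addrC.
- by move=> i; apply: vp; have := ltn_ord i; lia.
move=> i; under eq_bigr do rewrite E mulrDl.
rewrite big_split /= -ve; last by have := ltn_ord i; lia.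
congr (_ + _).
  transitivity (\sum_(j < h.+1 | j == i.+1 :> nat) s ^+ i * v j.+1).
    by rewrite [RHS]big_mkcond; apply: eq_bigr => j _; case: ifP => // _; rewrite mul0r.
  rewrite (big_ord1_eq _ (fun j => s ^+ i * v j.+1)) /=.
  case: ltnP => // ih; rewrite vz ?mulr0//; lia.
case: i => -[|i] ih /=.
  rewrite vz// mulr0; apply: big1 => j _; by rewrite mul0r.
transitivity (\sum_(j < h.+1 | j == i :> nat) s ^+ j * v j.+1).
  rewrite [RHS]big_mkcond; apply: eq_bigr => j _; rewrite eqSS eq_sym.
  by case: ifP => // _; rewrite mul0r.
by rewrite (big_ord1_eq _ (fun j => s ^+ j * v j.+1)) /= ltnW.
Qed.

(** * Branches and their crossings *)

Lemma Lambda_eigenpair (R : realType) (s : R) h : 0 < s ->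
  exists lam v, jacobi_eigenpair (fun i => s ^+ i.-1) 1 h.+1 lam v /\
    Lambda h.+1 (s ^+ 2) = lam ^+ 2.
Proof.
move=> s0; have [lam [v H]] := @jacobi_eigenpair_exists R (fun i => s ^+ i.-1) h
  (fun i => exprn_gt0 _ s0).
by exists lam, v; split => //; rewrite /Lambda (Amx_radius s0 H).
Qed.

Lemma Lambda_gt0 (R : realType) (r : R) k : 0 < r -> 0 < Lambda k.+2 r.
Proof.
move=> r0; rewrite -[r]sqr_sqrtr ?(ltW r0)//.
have s0 : 0 < Num.sqrt r by rewrite sqrtr_gt0.
have [lam [v [H ->]]] := Lambda_eigenpair k.+1 s0.
by rewrite exprn_gt0//; apply: eigenvalue_gt0 H => // i; rewrite ?exprn_gt0// ltW// exprn_gt0.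
Qed.

(* Submodularity for [1, k+3] and [2, k+4]; shifting a path by one vertex
   multiplies its eigenvalues by [sqrt r]. *)
Lemma Lambda_logconcave (R : realType) (r : R) k : 0 < r ->
  Lambda k.+2 r * Lambda k.+4 r <= Lambda k.+3 r ^+ 2.
Proof.
move=> r0; rewrite -[r]sqr_sqrtr ?(ltW r0)//; set s := Num.sqrt r.
have s0 : 0 < s by rewrite sqrtr_gt0.
have [l2 [v2 [H2 ->]]] := Lambda_eigenpair k.+1 s0.
have [l3 [v3 [H3 ->]]] := Lambda_eigenpair k.+2 s0.
have [l4 [v4 [H4 ->]]] := Lambda_eigenpair k.+3 s0.
have ap i : 0 < s ^+ i.-1 by rewrite exprn_gt0.
have ge0 h l v : jacobi_eigenpair (fun i => s ^+ i.-1) 1 h.+1 l v -> 0 <= l.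
  by apply: eigenvalue_ge0 => // i; rewrite ltW.
have sh h l v : jacobi_eigenpair (fun i => s ^+ i.-1) 1 h.+1 l v ->
    jacobi_eigenpair (fun i => s ^+ i.-1) 2 h.+2 (s * l) (fun i => v i.-1).
  by apply: jacobi_eigenpair_shift => // -[|i] // _; rewrite /= -exprS.
have := eigenvalue_submodular (m := k.+2) ap isT H3 (sh _ _ _ H3) H4 (sh _ _ _ H2).
rewrite mulrCA [l3 * _]mulrCA ler_pM2l// -!expr2 => H.
have [g2 g4] := (ge0 _ _ _ H2, ge0 _ _ _ H4).
rewrite -exprMn; apply: lerXn2r; last by rewrite mulrC.
  by rewrite nnegrE mulr_ge0.
by rewrite nnegrE sqr_ge0.
Qed.

(** Read backwards, the weights [1, s, ..., s^k] are [s^k] times the powers of [s^-1]. This is the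
    source of the symmetry between [p] and [q]. *)
Lemma Lambda_inv (R : realType) (r : R) k : 0 < r ->
  Lambda k.+2 r = r ^+ k * Lambda k.+2 r^-1.
Proof.
move=> r0; rewrite -[r]sqr_sqrtr ?(ltW r0)//; set s := Num.sqrt r.
have s0 : 0 < s by rewrite sqrtr_gt0.
have si0 : 0 < s^-1 by rewrite invr_gt0.
rewrite -exprVn; have [l [v [H ->]]] := Lambda_eigenpair k.+1 si0.
suff H' : jacobi_eigenpair (fun i => s ^+ i.-1) 1 k.+2 (s ^+ k * l)
    (fun i => if i is 0 then 0 else v (k.+3 - i)%N).
  by rewrite {1}/Lambda (Amx_radius s0 H') exprMn exprAC.
apply: (jacobi_eigenpair_rev _ H) => i ik.
have -> : s ^+ k = s ^+ (k - i.-1) * s ^+ i.-1 by rewrite -exprD subnK//; lia.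
rewrite (_ : (k.+2 - i).-1 = k - i.-1)%N; last by lia.
by rewrite mulrAC exprVn mulfV ?mul1r// expf_neq0// gt_eqF.
Qed.

Lemma Lambda_le4 (R : realType) (r : R) k : 0 < r -> r <= 1 -> Lambda k.+2 r <= 4.
Proof.
move=> r0 r1; rewrite -[r]sqr_sqrtr ?(ltW r0)//; set s := Num.sqrt r.
have s0 : 0 < s by rewrite sqrtr_gt0.
have s1 : s <= 1 by rewrite -sqrtr1 ler_sqrt.
have [l [v [H ->]]] := Lambda_eigenpair k.+1 s0.
have ap i : 0 < s ^+ i.-1 by rewrite exprn_gt0.
have l2 : l <= 2 * 1.
  apply: (eigenvalue_le ap _ ler01 H) => i _; apply: exprn_ile1 => //; exact: ltW.
have l0 : 0 <= l by apply: eigenvalue_ge0 H => // i; rewrite ltW.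
nra.
Qed.

Lemma sigma_gt0 (R : realType) (r : R) k : 0 < r -> (0 < k)%N -> 0 < sigma k r.
Proof. by case: k => // k r0 _; rewrite /sigma divr_gt0 ?Lambda_gt0. Qed.

Lemma sigma_le (R : realType) (r : R) i j : 0 < r -> (0 < i)%N -> (i <= j)%N ->
  sigma i r <= sigma j r.
Proof.
move=> r0 i0 /subnK <-; elim: (j - i)%N => // n; rewrite addSn => /le_trans; apply.
have : (0 < n + i)%N by lia.
case: (n + i)%N => // m _; rewrite /sigma ler_pdivrMr ?Lambda_gt0// mulrAC.
by rewrite ler_pdivlMr ?Lambda_gt0// -expr2 Lambda_logconcave.
Qed.

Lemma branch_gt0 (R : realType) (p q : R) k : 0 < p -> 0 < q -> (0 < k)%N ->
  0 < branch k p q.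
Proof.
case: k => // k p0 q0 _.
have r0 : 0 < q ^+ 2 / p ^+ 2 by rewrite divr_gt0 ?exprn_gt0.
by rewrite /branch div1r invr_gt0 mulr_gt0 ?Lambda_gt0// mulr_gt0// exprn_gt0.
Qed.

(** On a ray where [r = q^2 / p^2] is fixed, the order of two neighbouring branches is thereby
    reduced to the position of [p ^+ 2] relative to the number [sigma k r]. *)
Lemma branch_ratio (R : realType) (p q : R) k : 0 < p -> 0 < q -> (0 < k)%N ->
  branch k p q * sigma k (q ^+ 2 / p ^+ 2) = branch k.+1 p q * p ^+ 2.
Proof.
case: k => // k p0 q0 _; rewrite /branch /sigma.
rewrite (_ : (2 * k.+2 - 1 = (2 * k.+1 - 1) + 2)%N); last by lia.
set m := (2 * k.+1 - 1)%N.
have r0 : 0 < q ^+ 2 / p ^+ 2 by rewrite divr_gt0 ?exprn_gt0.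
have := gt_eqF (Lambda_gt0 k r0); have := gt_eqF (Lambda_gt0 k.+1 r0).
move: (Lambda _ _) (Lambda _ _) => A B; rewrite exprD.
have := gt_eqF (exprn_gt0 m p0); move: (p ^+ m) => P.
by have := gt_eqF p0; have := gt_eqF q0; move=> *; field; do ?[apply/andP; split]; apply/negbT.
Qed.

Lemma branch_leS (R : realType) (p q : R) k : 0 < p -> 0 < q -> (0 < k)%N ->
  (branch k p q <= branch k.+1 p q) = (p ^+ 2 <= sigma k (q ^+ 2 / p ^+ 2)).
Proof.
move=> p0 q0 k0; have r0 : 0 < q ^+ 2 / p ^+ 2 by rewrite divr_gt0 ?exprn_gt0.
have B0 := branch_gt0 p0 q0 k0.
have p2 : 0 < p ^+ 2 by rewrite exprn_gt0.
by rewrite -(ler_pM2r p2) -branch_ratio// ler_pM2l.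
Qed.

Lemma branch_geS (R : realType) (p q : R) k : 0 < p -> 0 < q -> (0 < k)%N ->
  (branch k.+1 p q <= branch k p q) = (sigma k (q ^+ 2 / p ^+ 2) <= p ^+ 2).
Proof.
move=> p0 q0 k0; have r0 : 0 < q ^+ 2 / p ^+ 2 by rewrite divr_gt0 ?exprn_gt0.
have B0 := branch_gt0 p0 q0 k0.
have p2 : 0 < p ^+ 2 by rewrite exprn_gt0.
by rewrite -(ler_pM2r p2) -branch_ratio// ler_pM2l.
Qed.

Lemma branch_eqS (R : realType) (p q : R) k : 0 < p -> 0 < q -> (0 < k)%N ->
  branch k p q = branch k.+1 p q <-> p ^+ 2 = sigma k (q ^+ 2 / p ^+ 2).
Proof.
move=> p0 q0 k0; split=> /eqP; rewrite eq_le.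
  by rewrite branch_leS// branch_geS// => H; apply/eqP; rewrite eq_le.
by rewrite -branch_leS// -branch_geS// => H; apply/eqP; rewrite eq_le.
Qed.

Lemma branch_sym (R : realType) (p q : R) k : 0 < p -> 0 < q -> (0 < k)%N ->
  branch k p q = branch k q p.
Proof.
move=> p0 q0 k0; rewrite -(prednK k0); move: k.-1 => {k0}k; rewrite /branch.
have r0 : 0 < q ^+ 2 / p ^+ 2 by rewrite divr_gt0 ?exprn_gt0.
rewrite (Lambda_inv k r0) invf_div.
move: (Lambda _ _) => L; congr (1 / _).
rewrite (_ : (2 * k.+1 - 1 = (2 * k).+1)%N); last by lia.
rewrite expr_div_n -!exprM !exprS.
have pk : p ^+ (2 * k) != 0 by rewrite expf_neq0// gt_eqF.
by move: (q ^+ _) => Q; move: (p ^+ _) pk => P pk; field.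
Qed.

(** As [sigma] is nondecreasing in the index, the branches at [s] first decrease and then increase,
    and [k] is active exactly when [sigma k.-1 r <= s <= sigma k r] (only the upper bound if
    [k = 1]). A bound satisfied at [s] and violated at [t] would be a value of [sigma] between the
    two, hence in [I]. *)
Lemma active_constant (R : realType) (r : R) (I : set R) : 0 < r ->
  is_interval I ->
  I `<=` [set s | 0 < s < Num.min 1 r^-1] ->
  (forall k : nat, (1 <= k)%N -> ~ I (sigma k r)) ->
  forall s t : R, I s -> I t ->
    active (Num.sqrt s) (Num.sqrt (r * s)) = active (Num.sqrt t) (Num.sqrt (r * t)).
Proof.
move=> r0 Iint Isub Isig.
suff sub s t : I s -> I t ->
    active (Num.sqrt s) (Num.sqrt (r * s)) `<=` active (Num.sqrt t) (Num.sqrt (r * t)).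
  by move=> s t Is It; apply/seteqP; split; apply: sub.
move=> Is It.
have pos u : I u -> 0 < u by move=> /Isub /= /andP[].
have ps u : I u -> 0 < Num.sqrt u by move=> /pos; rewrite sqrtr_gt0.
have qs u : I u -> 0 < Num.sqrt (r * u).
  by move=> /pos u0; rewrite sqrtr_gt0 mulr_gt0.
have E u : I u -> Num.sqrt (r * u) ^+ 2 / Num.sqrt u ^+ 2 = r.
  move=> /pos u0; rewrite !sqr_sqrtr ?mulfK ?gt_eqF// ltW// mulr_gt0//.
have leS u k : I u -> (0 < k)%N -> (branch k (Num.sqrt u) (Num.sqrt (r * u)) <=
    branch k.+1 (Num.sqrt u) (Num.sqrt (r * u))) = (u <= sigma k r).
  by move=> Iu k0; rewrite (branch_leS (ps u Iu) (qs u Iu) k0) (E u Iu) (sqr_sqrtr (ltW (pos u Iu))).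
have geS u k : I u -> (0 < k)%N -> (branch k.+1 (Num.sqrt u) (Num.sqrt (r * u)) <=
    branch k (Num.sqrt u) (Num.sqrt (r * u))) = (sigma k r <= u).
  by move=> Iu k0; rewrite (branch_geS (ps u Iu) (qs u Iu) k0) (E u Iu) (sqr_sqrtr (ltW (pos u Iu))).
move=> k [k1 kmin]; split; first exact: k1.
move=> j j1.
have ts : t <= sigma k r.
  rewrite leNgt; apply/negP => lt; apply: (Isig k k1).
  by apply: (Iint s t Is It); rewrite (ltW lt) -(leS s k Is k1) kmin.
case: (leqP k j) => [/subnK <-|jk].
  elim: (j - k)%N => [|n IH]; first exact: lexx.
  rewrite addSn; apply: (le_trans IH); rewrite (leS t _ It); last by lia.
  by apply: le_trans ts _; apply: (sigma_le r0 k1); lia.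
have kp : (0 < k.-1)%N by lia.
have st : sigma k.-1 r <= t.
  rewrite leNgt; apply/negP => lt; apply: (Isig k.-1 kp).
  apply: (Iint t s It Is); rewrite (ltW lt) -(geS s _ Is kp) (prednK k1).
  exact: kmin.
have mono i : (j <= i)%N -> (i < k)%N ->
    branch i.+1 (Num.sqrt t) (Num.sqrt (r * t)) <= branch j (Num.sqrt t) (Num.sqrt (r * t)).
  elim: i => [|i IH] ji ik; first by lia.
  have sik : sigma i.+1 r <= t by apply: le_trans st; apply: (sigma_le r0); lia.
  apply: (@le_trans _ _ (branch i.+1 (Num.sqrt t) (Num.sqrt (r * t)))).
    by rewrite (geS t _ It).
  move: ji; rewrite leq_eqVlt => /orP[/eqP ->|ji]; first exact: lexx.
  by apply: IH; lia.
by rewrite -(prednK k1); apply: mono; lia.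
Qed.

(** [r] can only be [q ^+ 2 / p ^+ 2], and along the curve the conditions [sigma k r < 1] and
    [sigma k r < r^-1] express [p < 1] and [q < 1]. *)
Lemma crossing_param (R : realType) k : (1 <= k)%N ->
  crossing R k =
  [set pq : R * R | 0 < pq.1 /\ 0 < pq.2 /\
     exists r : R,
       [/\ 0 < r, sigma k r < Num.min 1 r^-1,
           pq.1 ^+ 2 = sigma k r & pq.2 ^+ 2 = r * sigma k r]].
Proof.
move=> k1; apply/seteqP; split=> -[p q] /=.
  move=> [/andP[p0 p1] /andP[q0 q1] /branch_eqS H].
  split=> //; split=> //; exists (q ^+ 2 / p ^+ 2).
  rewrite -H//; have r0 : 0 < q ^+ 2 / p ^+ 2 by rewrite divr_gt0 ?exprn_gt0.
  have pn : p ^+ 2 != 0 by rewrite gt_eqF ?exprn_gt0.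
  split=> //; last by rewrite divfK.
  rewrite lt_min expr_lt1 ?ltW//= p1/= invfM invrK mulrC.
  by rewrite ltr_pMr ?exprn_gt0// invf_gt1 ?exprn_gt0// expr_lt1 ?ltW.
move=> [p0 [q0 [r [r0 sm Hp Hq]]]].
have s0 := sigma_gt0 r0 k1.
move: sm; rewrite lt_min => /andP[s1 sr].
have E : q ^+ 2 / p ^+ 2 = r by rewrite Hp Hq mulfK ?gt_eqF.
split.
- by rewrite p0 -(@expr_lt1 _ 2) ?(ltW p0)// Hp.
- rewrite q0 -(@expr_lt1 _ 2)//; last exact: ltW.
  by rewrite Hq mulrC -ltr_pdivlMr// div1r.
by apply/(branch_eqS p0 q0 k1); rewrite E.
Qed.

Lemma crossing_sym (R : realType) k : (1 <= k)%N ->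
  [set (pq.2, pq.1) | pq in crossing R k] = crossing R k.
Proof.
move=> k1.
have sub (p q : R) : crossing R k (p, q) -> crossing R k (q, p).
  rewrite /crossing /= => -[pb qb H]; have [/andP[p0 _] /andP[q0 _]] := (pb, qb).
  split; [exact: qb | exact: pb |].
  by rewrite -(branch_sym p0 q0 k1) -(branch_sym p0 q0 (ltn0Sn k)).
apply/seteqP; split=> [_ [[p q] H <-]|[p q] H].
  exact: (sub p q H).
by exists (q, p); [exact: (sub p q H) | reflexivity].
Qed.

(** By symmetry [q <= p], so [Lambda_le4] applies and the [j]-th branch is at least [1 / (4 p^j)].
    This tends to infinity, so from some index on every branch exceeds the first one and the minimum
    is over a finite set. *)
Lemma branch_min (R : realType) (p q : R) : 0 < p < 1 -> 0 < q < 1 ->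
  exists2 k, (1 <= k)%N & forall j, (1 <= j)%N -> branch k p q <= branch j p q.
Proof.
wlog qp : p q / q <= p.
  move=> wl pb qb; case: (leP q p) => [h|/ltW h]; first exact: (wl p q h pb qb).
  have [k k1 H] := wl q p h qb pb; exists k; first exact: k1.
  move=> j j1; have [/andP[p0 _] /andP[q0 _]] := (pb, qb).
  by rewrite (branch_sym p0 q0 k1) (branch_sym p0 q0 j1) H.
move=> /andP[p0 p1] /andP[q0 q1].
have r0 : 0 < q ^+ 2 / p ^+ 2 by rewrite divr_gt0 ?exprn_gt0.
have r1 : q ^+ 2 / p ^+ 2 <= 1.
  by rewrite ler_pdivrMr ?exprn_gt0// mul1r ler_sqr ?nnegrE ?(ltW p0) ?(ltW q0).
have B0 j : (1 <= j)%N -> 0 < branch j p q by move=> *; apply: branch_gt0.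
have lb j : (1 <= j)%N -> (4 * p ^+ j)^-1 <= branch j p q.
  case: j => // j _; rewrite /branch div1r lef_pV2 ?posrE; first last.
  - by rewrite mulr_gt0 ?Lambda_gt0// mulr_gt0// exprn_gt0.
  - by rewrite mulr_gt0 ?exprn_gt0.
  rewrite mulrC; apply: ler_pM (Lambda_le4 j r0 r1) _.
  + exact/ltW/Lambda_gt0.
  + by rewrite mulr_ge0 ?exprn_ge0 ?ltW.
  rewrite (_ : (2 * j.+1 - 1 = j.+1 + j)%N); last by lia.
  rewrite exprD -mulrA ler_piMr ?exprn_ge0 ?(ltW p0)//.
  by rewrite mulr_ile1 ?exprn_ile1 ?exprn_ge0 ?ltW.
have [N HN] : exists N, forall j, (N <= j)%N -> branch 1 p q < (4 * p ^+ j)^-1.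
  have p1' : `|p| < 1 by rewrite ger0_norm ?ltW.
  have e0 : 0 < (4 * branch 1 p q)^-1 by rewrite invr_gt0 mulr_gt0 ?B0.
  have /cvgrPdist_lt/(_ _ e0)[N _ HN] := cvg_expr p1'.
  exists N => j /HN /=; rewrite sub0r normrN ger0_norm ?exprn_ge0 ?ltW// => H.
  have b0 := B0 1%N isT; move: (branch 1 p q) b0 H => b b0.
  rewrite -div1r ltr_pdivlMr ?mulr_gt0// => H.
  by rewrite -div1r ltr_pdivlMr ?mulr_gt0 ?exprn_gt0//; lra.
have i1 : (1 <= @inord N.+1 1)%N by rewrite inordK.
case: (@arg_minP _ R 'I_N.+2 (inord 1) (fun k : 'I_N.+2 => (1 <= k)%N)
  (fun k : 'I_N.+2 => branch k p q) i1) => k k1 kmin.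
exists (k : nat); first exact: k1.
move=> j j1; case: (ltnP j N.+2) => jN; first exact: (kmin (Ordinal jN)).
apply: (@le_trans _ _ (branch 1 p q)); first by have := kmin _ i1; rewrite inordK.
apply: le_trans (lb j j1); apply/ltW/HN; lia.
Qed.

(** * Lattice words and gaps *)

Lemma vheight0 s : vheight s 0 = 0.
Proof. by rewrite /vheight take0 big_nil. Qed.

Lemma vheight_cons b s i :
  vheight (b :: s) i.+1 = (if b then 1 else -1) + vheight s i.
Proof. by rewrite /vheight /= big_cons. Qed.

Lemma vheightS s i : (i < size s)%N ->
  vheight s i.+1 = vheight s i + (if nth false s i then 1 else -1).
Proof.
by move=> si; rewrite /vheight (take_nth false)// -cats1 big_cat big_seq1.
Qed.

Lemma vheight_catr s t i :
  vheight (s ++ t) (size s + i) = vheight s (size s) + vheight t i.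
Proof.
rewrite /vheight take_cat ifF ?big_cat ?take_size ?addKn//; lia.
Qed.

Lemma vheight_catl s t i : (i <= size s)%N -> vheight (s ++ t) i = vheight s i.
Proof. by move=> si; rewrite /vheight takel_cat. Qed.

Lemma size_between s i j : (i < j)%N -> (j <= size s)%N ->
  size (between s i j) = (j - i.+1)%N.
Proof. by move=> ij js; rewrite size_drop size_takel. Qed.

Lemma vheight_between s i j m : (i.+1 + m <= j)%N ->
  vheight (between s i j) m = vheight s (i.+1 + m) - vheight s i.+1.
Proof.
move=> imj; rewrite /vheight /between take_drop take_takel; last by lia.
rewrite -[X in _ = \sum_(_ <- X) _ - _](cat_take_drop i.+1) big_cat /=.
by rewrite take_takel ?leq_addr// addrAC subrr add0r addnC.
Qed.

Lemma between_split s i l j : (i < l < j)%N -> (j <= size s)%N ->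
  between s i j = between s i l ++ nth false s l :: between s l j.
Proof.
move=> /andP[il lj] js; rewrite /between.
have ls : (l <= size s)%N by lia.
have -> : take j s = take l s ++ nth false s l :: drop l.+1 (take j s).
  rewrite -{1}(cat_take_drop l (take j s)) (take_takel _ (ltnW lj)).
  rewrite (drop_nth false (s := take j s)); last by rewrite size_takel.
  by rewrite nth_take.
rewrite drop_cat size_takel//; case: ltnP => li.
  by rewrite [in RHS]drop_cat size_takel// ltnNge leqnSn /= subSnn /= drop0.
have -> : i.+1 = l by lia.
by rewrite subnn drop0 (drop_oversize (s := take l s)) ?size_takel// drop_cat size_takel// ltnNge leqnSn /= subSnn /= drop0.
Qed.

(** Proper area of [w] started at height [z], in absolute values. For a piece of a gap at level [k]
    that starts at height [y], taking [z = y] gives its share of the area and [z = y - k] its share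
    of the water. *)
Fixpoint sarea (z : int) (w : seq bool) : nat :=
  if w is b :: w' then (`|z| + sarea (z + if b then 1 else -1)%R w')%N else 0%N.

Lemma sareaE z w : sarea z w = (\sum_(0 <= i < size w) `|(z + vheight w i)%R|)%N.
Proof.
elim: w z => [|b w IH] z; first by rewrite big_nil.
rewrite [RHS]big_nat_recl//= vheight0 addr0 IH; congr (_ + _)%N.
by apply: eq_bigr => i _; rewrite vheight_cons addrA.
Qed.

Lemma area_sarea w : area w = sarea 0 w.
Proof. by rewrite sareaE; apply: eq_bigr => i _; rewrite add0r. Qed.

Lemma vheight_reflect w i : vheight (reflect_path w) i = - vheight w i.
Proof.
rewrite /vheight /reflect_path -map_take big_map -sumrN.
by apply: eq_bigr => -[] _; rewrite ?opprK.
Qed.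

Lemma area_reflect w : area (reflect_path w) = sarea 0 w.
Proof.
rewrite -area_sarea /area size_map; apply: eq_bigr => i _.
by rewrite vheight_reflect abszN.
Qed.

Lemma sarea_cat z w1 w2 :
  sarea z (w1 ++ w2) = (sarea z w1 + sarea (z + vheight w1 (size w1))%R w2)%N.
Proof.
elim: w1 z => [|b w1 IH] z /=; first by rewrite vheight0 addr0.
by rewrite IH vheight_cons addrA addnA.
Qed.

(* [w], started at height [y], stays in [[0, k]] and ends at height [k]. *)
Fixpoint gapword (k y : nat) (w : seq bool) : bool :=
  (y <= k)%N && match w with
                | [::] => y == k
                | b :: w' => if b then gapword k y.+1 w'
                             else (0 < y)%N && gapword k y.-1 w'
                end.

Lemma gapwordP k y w : reflect
  ((forall i, (i <= size w)%N -> 0 <= y%:Z + vheight w i <= k%:Z) /\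
     y%:Z + vheight w (size w) = k%:Z)
  (gapword k y w).
Proof.
elim: w y => [|b w IH] y /=.
  rewrite vheight0 addr0; apply: (iffP andP) => [[yk /eqP <-]|[H [->]]].
    by split=> // i _; rewrite /vheight big_nil addr0 lexx andbT.
  by rewrite leqnn eqxx.
have C i : vheight (b :: w) i.+1 = (if b then 1 else -1) + vheight w i by exact: vheight_cons.
have [yk|yk] := leqP y k; last first.
  constructor => -[H _]; have := H 0%N isT; rewrite vheight0; lia.
rewrite /= C; case: b C => C.
  apply: (iffP (IH _)) => -[H1 H2]; split; try lia.
    by move=> [_|i si]; [rewrite vheight0; lia|rewrite C; have := H1 i si; lia].
  by move=> i si; have := H1 i.+1 si; rewrite C; lia.
apply: (iffP andP) => [[y0 /IH[H1 H2]]|[H1 H2]].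
  split; last by lia.
  by move=> [_|i si]; [rewrite vheight0; lia|rewrite C; have := H1 i si; lia].
have y0 : (0 < y)%N by have := H1 1%N isT; rewrite C vheight0; lia.
split=> //; apply/IH; split; last by lia.
by move=> i si; have := H1 i.+1 si; rewrite C; lia.
Qed.

Fixpoint words (n : nat) : seq (seq bool) :=
  if n is n'.+1 then [seq true :: w | w <- words n'] ++ [seq false :: w | w <- words n']
  else [:: [::]].

Lemma mem_words w : w \in words (size w).
Proof.
elim: w => [|b w IH] //=; rewrite mem_cat.
by case: b; rewrite map_f ?orbT.
Qed.

Lemma size_words n w : w \in words n -> size w = n.
Proof.
elim: n w => [|n IH] w /=; first by rewrite inE => /eqP ->.
by rewrite mem_cat => /orP[] /mapP[v /IH <- ->].
Qed.

Lemma uniq_words n : uniq (words n).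
Proof.
elim: n => //= n IH; rewrite cat_uniq !map_inj_uniq ?IH/= ?andbT => [|? ? []|? ? []]//.
by apply/hasPn => _ /mapP[w _ ->]; apply/mapP => -[].
Qed.

Fixpoint gapweight (R : realType) (c : nat -> R) (k i : nat) (w : seq bool) : R :=
  if (1 <= i <= k.+1)%N then
    if w is b :: w' then c i * gapweight c k (if b then i.+1 else i.-1) w'
    else (i == k.+1)%:R
  else 0.

Lemma sum_gapweight (R : realType) (c : nat -> R) k n i :
  \sum_(w <- words n) gapweight c k i w =
  walk c c 1 k.+1 (fun i => (i == k.+1)%:R) n i.
Proof.
elim: n i => [|n IH] i; first by rewrite big_seq1 /=; case: ifP.
rewrite big_cat !big_map /=; case: ifP => // _; last by rewrite !big1_eq addr0.
by rewrite -!mulr_sumr !IH.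
Qed.

Lemma gapweight_ge0 (R : realType) (c : nat -> R) k i w :
  (forall i, 0 <= c i) -> 0 <= gapweight c k i w.
Proof.
move=> c0; elim: w i => [|b w IH] i /=; case: ifP => // _.
by rewrite mulr_ge0.
Qed.

(* Contribution of a step leaving height [i.-1] inside a gap at level [k], where
   [X] stands for the square root of [x]; positions are heights plus one, so that
   [0] lies outside of every path. *)
Definition gapstep (R : realType) (X p q : R) (k i : nat) : R :=
  X * p ^+ (k.+1 - i) * q ^+ i.-1.

Lemma gapweightE (R : realType) (X p q : R) k y w :
  gapweight (gapstep X p q k) k y.+1 w =
  if gapword k y w then
    X ^+ size w * p ^+ sarea (y%:Z - k%:Z) w * q ^+ sarea y w
  else 0.
Proof.
elim: w y => [|b w IH] y /=; rewrite ltnS; case: (leqP y k) => //= yk.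
  by rewrite eqSS; case: eqP => // _; rewrite !expr0 !mulr1.
have E : gapstep X p q k y.+1 = X * p ^+ `|y%:Z - k%:Z|%N * q ^+ `|y|%N.
  by rewrite /gapstep; congr (_ * _ ^+ _ * _ ^+ _); lia.
case: b.
  rewrite /= IH; case: ifP => _; last by rewrite mulr0.
  rewrite E (_ : y.+1%:Z - k%:Z = y%:Z - k%:Z + 1); last by lia.
  rewrite (_ : y.+1%:Z = y%:Z + 1); last by lia.
  rewrite exprS !exprD; ring.
case: y yk E => [|y] yk E /=.
  (* A down-step from height 0 leads to position 0, outside [[1, k.+1]], where the weight
     vanishes. *)
  by case: w {IH} => [|b w] /=; rewrite mulr0.
rewrite IH; case: ifP => _; last by rewrite mulr0.
rewrite E (_ : y.+1%:Z - k%:Z - 1 = y%:Z - k%:Z); last by lia.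
rewrite (_ : y.+1%:Z - 1 = y%:Z); last by lia.
rewrite exprS !exprD; ring.
Qed.

(** * Marked steps and the decomposition of a Dyck path *)

Lemma dyckP s : reflect
  ((forall i, (i <= size s)%N -> 0 <= vheight s i) /\ vheight s (size s) = 0)
  (is_dyck s).
Proof.
apply: (iffP andP) => -[H1 H2]; split.
- by move=> i si; apply: (allP H1); rewrite mem_iota.
- exact/eqP.
- by apply/allP => i; rewrite mem_iota => si; apply: H1.
- exact/eqP.
Qed.

Lemma vheight_le_height s i : (i <= size s)%N -> vheight s i <= (height s)%:Z.
Proof.
move=> si; apply: (@le_trans _ _ (`|vheight s i|%N)%:Z); first by lia.
rewrite lez_nat /height.
by apply: (leq_bigmax_seq (F := fun i => `|vheight s i|%N)); rewrite ?mem_index_iota.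
Qed.

Lemma height_attained s : is_dyck s ->
  exists2 i, (i <= size s)%N & vheight s i = (height s)%:Z.
Proof.
move=> /dyckP[H _]; rewrite /height big_mkord.
have [|i ->] := @bigop.eq_bigmax _ (fun i : 'I_(size s).+1 => `|vheight s i|%N).
  by rewrite card_ord.
have si : (i <= size s)%N by rewrite -ltnS.
by exists i => //; have := H i si; lia.
Qed.

Lemma height_le_size s : (height s <= size s)%N.
Proof.
rewrite /height; apply/bigmax_leqP_seq => i; rewrite mem_index_iota => /= si _.
have {}si : (i <= size s)%N by [].
elim: i si => [|i IH] si; first by rewrite vheight0.
suff : (`|vheight s i.+1| <= i.+1)%N by lia.
elim: {IH}i.+1 si => [|j IH] si; first by rewrite vheight0.
by have := IH (ltnW si); rewrite vheightS//; case: nth; lia.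
Qed.

Lemma up_markP s k : is_dyck s -> (0 < k <= height s)%N ->
  let U := up_mark s k in
  [/\ (U < size s)%N, nth false s U, vheight s U = k%:Z - 1
    & forall i, (i <= U)%N -> vheight s i <= k%:Z - 1].
Proof.
move=> ds kh U; have [d1 d2] := dyckP _ ds.
pose P i := nth false s i && (vheight s i == k%:Z - 1).
have low m : (m <= size s)%N -> (forall i, (i < m)%N -> ~~ P i) ->
    forall i, (i <= m)%N -> vheight s i <= k%:Z - 1.
  move=> ms H; elim=> [|i IH] im; first by rewrite vheight0; lia.
  rewrite vheightS; last by lia.
  have := IH (ltnW im); have := H i im; rewrite /P; case: nth => /=; lia.
(* Otherwise the path would stay below level [k], although it attains its height. *)
have hP : has P (iota 0 (size s)).
  apply: contraT => /hasPn H.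
  have [i si hi] := height_attained ds.
  have := @low (size s) (leqnn _) _ i si; rewrite hi => /(_ _) h.
  suff : (height s)%:Z <= k%:Z - 1 by lia.
  by apply: h => j js; apply: H; rewrite mem_iota.
have Us : (U < size s)%N by have := hP; rewrite has_find size_iota.
have /andP[n1 /eqP n2] : P U.
  by have := nth_find 0%N hP; rewrite -/(up_mark s k) nth_iota.
split=> //; apply: low (ltnW Us) _ => i iU.
by have /negbT := before_find 0%N iU; rewrite nth_iota//; lia.
Qed.

Lemma bigmax_nat_attained n (Q : pred nat) : (exists2 i, (i < n)%N & Q i) ->
  Q (\max_(0 <= i < n | Q i) i) /\ (\max_(0 <= i < n | Q i) i < n)%N.
Proof.
elim: n => [[]//|n IH] [i ni Qi].
have -> : (\max_(0 <= i < n.+1 | Q i) i =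
    maxn (\max_(0 <= i < n | Q i) i) (if Q n then n else 0))%N.
  by rewrite big_mkcond big_nat_recr//= -big_mkcond.
case: (boolP (Q n)) => Qn.
  have -> : maxn (\max_(0 <= i < n | Q i) i) n = n; last by [].
  by apply/maxn_idPr/bigmax_leqP_seq => j; rewrite mem_index_iota; lia.
rewrite maxn0; have [|h1 h2] := IH; last by split=> //; apply: ltnW.
exists i => //; rewrite ltn_neqAle -ltnS ni andbT.
by apply/eqP => E; move: Qn; rewrite -E Qi.
Qed.

Lemma down_markP s k : is_dyck s -> (0 < k <= height s)%N ->
  let D := down_mark s k in
  [/\ (D < size s)%N, ~~ nth false s D, vheight s D = k%:Z
    & forall i, (D < i <= size s)%N -> vheight s i <= k%:Z - 1].
Proof.
move=> ds kh D; have [d1 d2] := dyckP _ ds.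
pose Q i := ~~ nth true s i && (vheight s i == k%:Z).
have low m : (forall i, (m <= i < size s)%N -> ~~ Q i) ->
    forall i, (m <= i <= size s)%N -> vheight s i <= k%:Z - 1.
  (* Induction on the distance from the end of the path, where the height is 0. *)
  move=> H i /andP[mi si]; rewrite -(subKn si).
  have : (size s - i <= size s - m)%N by lia.
  elim: (size s - i)%N => [|j IH] jm; first by rewrite subn0 d2; lia.
  have js : (size s - j = (size s - j.+1).+1)%N by lia.
  have := IH (ltnW jm); rewrite js vheightS; last by lia.
  have /= := H (size s - j.+1)%N ltac:(lia).
  rewrite /Q (set_nth_default false); last by lia.
  by case: nth => /=; lia.
have eQ : exists2 i, (i < size s)%N & Q i.
  apply: contrapT => nQ.
  have [i si hi] := height_attained ds.
  have := @low 0%N _ i si; rewrite hi => h.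
  suff : (height s)%:Z <= k%:Z - 1 by lia.
  by apply: h => j /= js; apply/negP => Qj; apply: nQ; exists j.
have [/andP[q1 /eqP q2] q3] := bigmax_nat_attained eQ.
split=> //; first by rewrite (set_nth_default true).
apply: low => i /andP[Di si]; apply/negP => Qi.
have : (i <= D)%N.
  by apply: (leq_bigmax_seq (F := id)); rewrite ?mem_index_iota.
by rewrite leqNgt Di.
Qed.

(** It comprises all gaps at level [k] and above, so the path can be peeled level by level from the
    outside. *)
Definition core (s : seq bool) (k : nat) : seq bool :=
  between s (up_mark s k) (down_mark s k).

Lemma up_lt_down s k : is_dyck s -> (0 < k <= height s)%N ->
  (up_mark s k < down_mark s k)%N.
Proof.
move=> ds kh; have [u1 u2 u3 u4] := up_markP ds kh.
have [d1 d2 d3 d4] := down_markP ds kh.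
by rewrite ltnNge; apply/negP => /u4; rewrite d3; lia.
Qed.

Lemma up_mark_mono s k : is_dyck s -> (0 < k < height s)%N ->
  (up_mark s k < up_mark s k.+1)%N.
Proof.
move=> ds kh.
have k1 : (0 < k <= height s)%N by lia.
have k2 : (0 < k.+1 <= height s)%N by lia.
have [u1 u2 u3 u4] := up_markP ds k1; have [v1 v2 v3 v4] := up_markP ds k2.
by rewrite ltnNge; apply/negP => /u4; rewrite v3; lia.
Qed.

Lemma down_mark_mono s k : is_dyck s -> (0 < k < height s)%N ->
  (down_mark s k.+1 < down_mark s k)%N.
Proof.
move=> ds kh.
have k1 : (0 < k <= height s)%N by lia.
have k2 : (0 < k.+1 <= height s)%N by lia.
have [u1 u2 u3 u4] := down_markP ds k1; have [v1 v2 v3 v4] := down_markP ds k2.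
rewrite ltn_neqAle; apply/andP; split.
  by apply/eqP => E; move: v3; rewrite E u3; lia.
rewrite leqNgt; apply/negP => lt; have := u4 (down_mark s k.+1) ltac:(lia).
by rewrite v3; lia.
Qed.

Lemma core_split s k : is_dyck s -> (0 < k < height s)%N ->
  core s k = left_gap s k ++ true :: core s k.+1 ++ false :: right_gap s k.
Proof.
move=> ds kh; have k1 : (0 < k <= height s)%N by lia.
have k2 : (0 < k.+1 <= height s)%N by lia.
have [u1 u2 _ _] := up_markP ds k2; have [d1 d2 _ _] := down_markP ds k2.
have [d3 _ _ _] := down_markP ds k1.
have h1 := up_mark_mono ds kh; have h2 := down_mark_mono ds kh.
have h3 := up_lt_down ds k2.
rewrite /core (@between_split _ _ (up_mark s k.+1)); [|lia|lia].
rewrite (@between_split _ (up_mark s k.+1) (down_mark s k.+1)); [|lia|lia].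
by rewrite u2 (negbTE d2).
Qed.

Lemma gapword_between s k i j : is_dyck s -> (i < j)%N -> (j <= size s)%N ->
  vheight s i.+1 = k%:Z -> vheight s j = k%:Z ->
  (forall l, (i < l <= j)%N -> vheight s l <= k%:Z) ->
  gapword k k (between s i j).
Proof.
move=> /dyckP[d1 d2] ij js hi hj H; have sz := size_between ij js.
apply/gapwordP; split=> [l|].
  rewrite sz => lj; rewrite vheight_between; last by lia.
  rewrite hi addrC subrK d1; last by lia.
  by rewrite H//; lia.
rewrite vheight_between sz; last by lia.
by rewrite hi subnKC// hj; lia.
Qed.

Lemma left_gapP s k : is_dyck s -> (0 < k < height s)%N ->
  gapword k k (left_gap s k).
Proof.
move=> ds kh; have k1 : (0 < k <= height s)%N by lia.
have k2 : (0 < k.+1 <= height s)%N by lia.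
have [u1 u2 u3 u4] := up_markP ds k2; have [v1 v2 v3 v4] := up_markP ds k1.
have h1 := up_mark_mono ds kh.
apply: gapword_between => //; first exact: ltnW.
- by rewrite vheightS// v2 v3; lia.
- by rewrite u3; lia.
- by move=> l /andP[_ /u4]; lia.
Qed.

Lemma right_gapP s k : is_dyck s -> (0 < k < height s)%N ->
  gapword k k (right_gap s k).
Proof.
move=> ds kh; have k1 : (0 < k <= height s)%N by lia.
have k2 : (0 < k.+1 <= height s)%N by lia.
have [u1 u2 u3 u4] := down_markP ds k2; have [v1 v2 v3 v4] := down_markP ds k1.
have h1 := down_mark_mono ds kh.
apply: gapword_between => //; first exact: ltnW.
- by rewrite vheightS// (negbTE u2) u3; lia.
- by move=> l /andP[l1 l2]; have := u4 l ltac:(lia); lia.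
Qed.

Lemma top_gapP s : is_dyck s -> (0 < height s)%N ->
  gapword (height s) (height s) (top_gap s).
Proof.
move=> ds h0; have k1 : (0 < height s <= height s)%N by lia.
have [u1 u2 u3 u4] := up_markP ds k1; have [v1 v2 v3 v4] := down_markP ds k1.
have h1 := up_lt_down ds k1.
apply: gapword_between => //; first exact: ltnW.
- by rewrite vheightS// u2 u3; lia.
- by move=> l /andP[l1 l2]; apply: vheight_le_height; lia.
Qed.

(** There is no gap at level 0: the path must rise at once and can only reach the axis for good with
    its last step, so [U_1] and [D_1] are its first and last steps. *)
Lemma dyck_core1 s : is_dyck s -> (0 < height s)%N ->
  s = true :: core s 1 ++ [:: false].
Proof.
move=> ds h0; have k1 : (0 < 1 <= height s)%N by lia.
have [u1 u2 u3 u4] := up_markP ds k1; have [v1 v2 v3 v4] := down_markP ds k1.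
have h1 := up_lt_down ds k1; have [d1 d2] := dyckP _ ds.
have U0 : up_mark s 1 = 0%N.
  apply/eqP; rewrite -leqn0 leqNgt; apply/negP => U0.
  have := u4 1%N U0; have := d1 1%N ltac:(lia).
  rewrite vheightS; last by lia.
  rewrite vheight0; case E : (nth false s 0) => /=; lia.
have D1 : (down_mark s 1).+1 = size s.
  apply/eqP; rewrite eqn_leq v1 leqNgt; apply/negP => D1.
  have ss : ((size s).-1.+1 = size s)%N by lia.
  have := v4 (size s).-1 ltac:(lia); have := d1 (size s).-1 ltac:(lia).
  have : vheight s (size s).-1.+1 = 0 by rewrite ss.
  rewrite vheightS; last by lia.
  by case: nth => /=; lia.
have s0 : s = take 1 s ++ drop 1 s by rewrite cat_take_drop.
rewrite /core /between U0.
rewrite {1}s0 (take_nth false) ?take0; last by lia.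
rewrite -{1}U0 u2 /=; congr (_ :: _).
rewrite -{1}(take_size s) -D1 (take_nth false)// (negbTE v2) -cats1 drop_cat.
rewrite size_takel ?(ltnW v1)//; case: ltnP => // D2.
have -> : down_mark s 1 = 1%N by lia.
by rewrite (drop_oversize (s := take 1 s)) ?size_takel//; lia.
Qed.

Lemma height0_nil s : is_dyck s -> height s = 0%N -> s = [::].
Proof.
move=> /dyckP[d1 d2] h0; case: s d1 d2 h0 => // b s d1 d2 h0.
have := d1 1%N isT; have := @vheight_le_height (b :: s) 1 isT.
by rewrite h0 vheight_cons vheight0; case: b {d1 d2 h0}.
Qed.

(** * The generating function *)

Lemma sum_uniq_le (R : realType) (T : eqType) (F : T -> R) (s1 s2 : seq T) :
  uniq s1 -> {subset s1 <= s2} -> (forall x, x \in s2 -> 0 <= F x) ->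
  \sum_(x <- s1) F x <= \sum_(x <- s2) F x.
Proof.
elim: s1 s2 => [|x s1 IH] s2 /=.
  by move=> _ _ F0; rewrite big_nil big_seq sumr_ge0.
move=> /andP[xs1 us1] sub F0.
have xs2 : x \in s2 by apply: sub; rewrite mem_head.
rewrite big_cons (perm_big _ (perm_to_rem xs2)) big_cons lerD2l.
apply: IH => // [y ys1|y /mem_rem]; last exact: F0.
have : y \in s2 by apply: sub; rewrite inE ys1 orbT.
rewrite (perm_mem (perm_to_rem xs2)) inE => /orP[/eqP E|//].
by rewrite -E ys1 in xs1.
Qed.

(** The keys [g t] keep terms of equal value apart, so the nonzero terms form a list without
    repetitions contained in [L]. *)
Lemma sum_inj_le (R : realType) (T : eqType) (U : eqType) (s : seq T) (g : T -> U)
    (F : T -> R) (L : seq (U * R)) :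
  uniq s -> injective g -> (forall t, t \in s -> F t != 0 -> (g t, F t) \in L) ->
  (forall x, x \in L -> 0 <= x.2) ->
  \sum_(t <- s) F t <= \sum_(x <- L) x.2.
Proof.
move=> us ginj FL L0.
rewrite (bigID (fun t => F t != 0)) /= [X in _ + X]big1 ?addr0; last first.
  by move=> t; rewrite negbK => /eqP.
rewrite -big_filter -(big_map (fun t => (g t, F t)) xpredT (fun x => x.2)).
apply: sum_uniq_le => //.
  by rewrite map_inj_uniq ?filter_uniq// => t t' [/ginj].
by move=> x /mapP[t]; rewrite mem_filter => /andP[Ft ts] ->; apply: FL.
Qed.

(* Words paired with their weights.  A Dyck path of height [h] is reassembled
   from its gaps as an element of [cores N 0 h], which bounds a sum over paths by
   a product over gaps without deciding whether the decomposition is unique. *)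
Definition gaps (R : realType) (X p q : R) (N k : nat) : seq (seq bool * R) :=
  [seq (w, gapweight (gapstep X p q k) k k.+1 w) | w <- flatten [seq words n | n <- iota 0 N.+1]].

Arguments gaps : simpl never.

Fixpoint cores (R : realType) (X p q : R) (N k d : nat) : seq (seq bool * R) :=
  if d is d'.+1 then
    [seq (g.1 ++ true :: cg.1.1 ++ false :: cg.2.1,
          X ^+ 2 * q ^+ (2 * k).+1 * (g.2 * (cg.1.2 * cg.2.2)))
      | g <- gaps X p q N k,
        cg <- [seq (c, g') | c <- cores X p q N k.+1 d', g' <- gaps X p q N k]]
  else gaps X p q N k.

Lemma coresS (R : realType) (X p q : R) N k d :
  cores X p q N k d.+1 =
  [seq (g.1 ++ true :: cg.1.1 ++ false :: cg.2.1,
        X ^+ 2 * q ^+ (2 * k).+1 * (g.2 * (cg.1.2 * cg.2.2)))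
    | g <- gaps X p q N k,
      cg <- [seq (c, g') | c <- cores X p q N k.+1 d, g' <- gaps X p q N k]].
Proof. by []. Qed.

Lemma gaps_ge0 (R : realType) (X p q : R) N k x : 0 <= X -> 0 <= p -> 0 <= q ->
  x \in gaps X p q N k -> 0 <= x.2.
Proof.
move=> X0 p0 q0 /mapP[w _ ->]; apply: gapweight_ge0 => i.
by rewrite !mulr_ge0 ?exprn_ge0.
Qed.

Lemma cores_ge0 (R : realType) (X p q : R) N k d x : 0 <= X -> 0 <= p -> 0 <= q ->
  x \in cores X p q N k d -> 0 <= x.2.
Proof.
move=> X0 p0 q0; elim: d k x => [|d IH] k x; first exact: gaps_ge0.
rewrite coresS.
move=> /allpairsPdep[g [_ [Hg /allpairsPdep[c [g' [Hc Hg' ->]]] ->]]] /=.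
by rewrite !mulr_ge0 ?exprn_ge0 ?(gaps_ge0 _ _ _ Hg) ?(IH _ _ Hc) ?(gaps_ge0 _ _ _ Hg').
Qed.

(** There are [2 d + 1] gaps, each costing a factor [C], and [2 d] marked steps. At level [j] the
    latter have area [2 j - 1], and these odd numbers for [k < j <= k + d] add up to
    [(k + d)^2 - k^2]. *)
Lemma sum_cores (R : realType) (X p q C : R) N k d : 0 <= X -> 0 <= p -> 0 <= q ->
  (forall k, \sum_(g <- gaps X p q N k) g.2 <= C) ->
  \sum_(c <- cores X p q N k d) c.2 <=
    C * (X ^+ 2 * C ^+ 2) ^+ d * q ^+ (d ^ 2 + 2 * k * d).
Proof.
move=> X0 p0 q0 HC.
have g0 k' : 0 <= \sum_(g <- gaps X p q N k') g.2.
  by rewrite big_seq sumr_ge0// => g; exact: gaps_ge0.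
elim: d k => [|d IH] k; first by rewrite muln0 !expr0 !mulr1 HC.
set Sg := \sum_(g <- gaps X p q N k) g.2.
set Sc := \sum_(c <- cores X p q N k.+1 d) c.2.
have -> : \sum_(c <- cores X p q N k d.+1) c.2 =
    X ^+ 2 * q ^+ (2 * k).+1 * (Sg * (Sc * Sg)).
  rewrite coresS big_allpairs_dep [Sg * (_ * _)]mulr_suml mulr_sumr.
  apply: eq_bigr => g _; rewrite big_allpairs_dep /= [Sc * Sg]mulr_suml 2!mulr_sumr.
  by apply: eq_bigr => c _; rewrite !mulr_sumr.
have Sc0 : 0 <= Sc by rewrite /Sc big_seq sumr_ge0// => c; exact: cores_ge0.
have Sg0 : 0 <= Sg by exact: g0.
have C0 : 0 <= C by exact: le_trans (HC k).
have -> : C * (X ^+ 2 * C ^+ 2) ^+ d.+1 * q ^+ (d.+1 ^ 2 + 2 * k * d.+1) =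
    X ^+ 2 * q ^+ (2 * k).+1 *
    (C * (C * (X ^+ 2 * C ^+ 2) ^+ d * q ^+ (d ^ 2 + 2 * k.+1 * d) * C)).
  rewrite (_ : (d.+1 ^ 2 + 2 * k * d.+1 = (2 * k).+1 + (d ^ 2 + 2 * k.+1 * d))%N).
    by rewrite exprS exprD; ring.
  by rewrite -!mulnn; lia.
apply: ler_wpM2l; first by rewrite mulr_ge0 ?exprn_ge0.
apply: ler_pM => //; [by rewrite mulr_ge0 | exact: HC |].
by apply: ler_pM => //; [exact: IH | exact: HC].
Qed.

Lemma mem_gaps (R : realType) (X p q : R) N k w : gapword k k w -> (size w <= N)%N ->
  (w, X ^+ size w * p ^+ sarea 0 w * q ^+ sarea k w) \in gaps X p q N k.
Proof.
move=> kw wN; apply/mapP; exists w.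
  apply/flattenP; exists (words (size w)); last exact: mem_words.
  by apply/mapP; exists (size w) => //; rewrite mem_iota.
by rewrite gapweightE kw subrr.
Qed.

(** The share of [water s] that lies in [core s k]. *)
Definition water_above (s : seq bool) (k : nat) : nat :=
  (\sum_(k <= j < height s)
      (area (reflect_path (left_gap s j)) + area (reflect_path (right_gap s j)))
   + area (reflect_path (top_gap s)))%N.

Lemma mem_cores (R : realType) (X p q : R) N s k d : is_dyck s -> (size s <= N)%N ->
  (0 < k)%N -> (k + d = height s)%N ->
  (core s k, X ^+ size (core s k) * p ^+ water_above s k * q ^+ sarea k (core s k))
    \in cores X p q N k d.
Proof.
move=> ds sN; have sub i j : (size (between s i j) <= N)%N.
  by rewrite size_drop size_take; case: ifP; lia.
elim: d k => [|d IH] k k0 kd.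
  have E : k = height s by lia.
  rewrite /water_above E big_geq// add0n area_reflect.
  by apply: mem_gaps; [apply: (top_gapP ds); lia | exact: sub].
have kh : (0 < k < height s)%N by lia.
have := IH k.+1 isT ltac:(lia); move: (core_split ds kh).
have := mem_gaps X p q (left_gapP ds kh) (sub _ _).
have := mem_gaps X p q (right_gapP ds kh) (sub _ _).
have -> : water_above s k = (sarea 0 (left_gap s k) + sarea 0 (right_gap s k) + water_above s k.+1)%N.
  rewrite /water_above big_ltn; last by lia.
  by rewrite -!area_reflect addnA.
have /gapwordP[_ hl] := left_gapP ds kh.
have hc : vheight (core s k.+1) (size (core s k.+1)) = 0.
  have k2 : (0 < k.+1 <= height s)%N by lia.
  have [u1 u2 u3 u4] := up_markP ds k2; have [v1 v2 v3 v4] := down_markP ds k2.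
  have ud := up_lt_down ds k2.
  rewrite vheight_between size_between//; try lia.
  rewrite subnKC// vheightS// u2 u3 v3; lia.
move: (left_gap s k) hl (right_gap s k) => lg hl rg.
move: (core s k.+1) hc => c hc hrg hlg -> hc'.
rewrite coresS.
apply/allpairsPdep; exists (lg, X ^+ size lg * p ^+ sarea 0 lg * q ^+ sarea k lg),
  ((c, X ^+ size c * p ^+ water_above s k.+1 * q ^+ sarea k.+1 c),
   (rg, X ^+ size rg * p ^+ sarea 0 rg * q ^+ sarea k rg)); split; first exact: hlg.
  by apply/allpairsPdep; eexists _, _; split; [exact: hc'|exact: hrg|].
congr (_, _); rewrite /=.
rewrite sarea_cat /= sarea_cat /= hc (_ : k%:Z + vheight lg (size lg) = k%:Z); last by lia.
rewrite (_ : k%:Z + 1 + 0 = k.+1%:Z); last by lia.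
rewrite (_ : k%:Z + 1 = k.+1%:Z); last by lia.
rewrite (_ : k.+1%:Z - 1 = k%:Z); last by lia.
rewrite !size_cat /= size_cat /=.
rewrite (_ : (size lg + (size c + (size rg).+1).+1 = 2 + size lg + size c + size rg)%N); last by lia.
rewrite (_ : (sarea k lg + (k + (sarea k.+1 c + (k.+1 + sarea k rg))) =
  (2 * k).+1 + sarea k lg + sarea k.+1 c + sarea k rg)%N); last by lia.
by rewrite !exprD; ring.
Qed.

Lemma mem_cores_dyck (R : realType) (X p q : R) N s : is_dyck s -> (size s <= N)%N ->
  (s, X ^+ size s * p ^+ water s * q ^+ area s) \in cores X p q N 0 (height s).
Proof.
move=> ds sN; case: (posnP (height s)) => h0.
  have w0 : water s = 0%N by rewrite /water h0.
  rewrite w0 h0 area_sarea (height0_nil ds h0).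
  exact: (@mem_gaps _ X p q N 0 [::]).
(* [cores] provides for gaps at level 0 as well; a Dyck path has none there, and the empty word of
   weight 1 fills the place. *)
have g0 : ([::], 1) \in gaps X p q N 0.
  by have := @mem_gaps _ X p q N 0 [::] isT isT; rewrite /= !expr0 !mulr1.
have := mem_cores X p q (k := 1) (d := (height s).-1) ds sN isT ltac:(lia).
have Es := dyck_core1 ds h0.
have hc : vheight (core s 1) (size (core s 1)) = 0.
  have [_] := dyckP _ ds; move: Es; move: (core s 1) => c ->.
  by rewrite /= size_cat /= vheight_cons vheight_catr vheight_cons vheight0; lia.
have -> : water s = water_above s 1 by rewrite /water /water_above gtn_eqF.
rewrite -(prednK h0) coresS => hcore.
apply/allpairsPdep; exists ([::], 1), ((core s 1, X ^+ size (core s 1) * p ^+ water_above s 1 *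
  q ^+ sarea 1 (core s 1)), ([::], 1)); split; first exact: g0.
  by apply/allpairsPdep; eexists _, _; split; [exact: hcore|exact: g0|].
rewrite /= -Es; congr (_, _).
rewrite area_sarea; move: (water_above s 1) (core s 1) Es hc {hcore} => m c Es hc.
rewrite Es /= size_cat sarea_cat hc /=.
rewrite (_ : (0 + (sarea (0 + 1) c + (1 + 0)) = 1 + sarea 1 c)%N); last by rewrite add0r; lia.
by rewrite !mul1r !mulr1 addn1 exprD !exprS expr0; ring.
Qed.

Lemma sum_gaps (R : realType) (X p q : R) N k :
  \sum_(g <- gaps X p q N k) g.2 =
  \sum_(n < N.+1) walk (gapstep X p q k) (gapstep X p q k) 1 k.+1
    (fun i => (i == k.+1)%:R) n k.+1.
Proof.
rewrite /gaps -[iota 0 N.+1]/(index_iota 0 N.+1) big_map big_flatten big_map big_mkord.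
by apply: eq_bigr => n _; rewrite -sum_gapweight.
Qed.

Lemma big_enum_filter (R : realType) (T : finType) (P : pred T) (F : T -> R) :
  \sum_(t | P t) F t = \sum_(t <- [seq t <- enum T | P t]) F t.
Proof. by rewrite big_filter big_enum_cond. Qed.

Lemma dyck_coef_le (R : realType) (X p q C : R) n : 0 <= X -> 0 <= p -> 0 <= q ->
  (forall N k, \sum_(g <- gaps X p q N k) g.2 <= C) ->
  X ^+ n.*2 * dyck_coef p q n <=
    \sum_(h < n.*2.+1) C * (X ^+ 2 * C ^+ 2) ^+ h * q ^+ (h ^ 2).
Proof.
move=> X0 p0 q0 HC; set N := n.*2.
rewrite /dyck_coef mulr_sumr big_enum_filter.
pose L := flatten [seq cores X p q N 0 h | h <- iota 0 N.+1].
have L0 x : x \in L -> 0 <= x.2 by move=> /flatten_mapP[h _]; exact: cores_ge0.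
apply: (@le_trans _ _ (\sum_(x <- L) x.2)); last first.
  rewrite big_flatten big_map -[iota 0 N.+1]/(index_iota 0 N.+1) big_mkord.
  apply: ler_sum => h _; have := sum_cores 0 h X0 p0 q0 (HC N).
  by rewrite muln0 mul0n addn0.
apply: (sum_inj_le (g := val)); last exact: L0.
- by rewrite filter_uniq// enum_uniq.
- exact: val_inj.
move=> s; rewrite mem_filter => /andP[ds _] _.
have sN : size s = N by rewrite size_tuple.
apply/flattenP; exists (cores X p q N 0 (height s)).
  apply/mapP; exists (height s) => //; rewrite mem_iota /= ltnS -sN.
  exact: height_le_size.
have := @mem_cores_dyck _ X p q N s ds; rewrite sN => /(_ (leqnn _)).
by rewrite mulrA.
Qed.

(** * Dyck paths with at most one nonempty gap *)

Definition tower (k : nat) (g : seq bool) : seq bool :=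
  nseq k true ++ g ++ nseq k false.

Lemma vheight_ups k i : (i <= k)%N -> vheight (nseq k true) i = i%:Z.
Proof.
elim: i k => [|i IH] [|k] // ik; rewrite ?vheight0// vheight_cons IH//; lia.
Qed.

Lemma vheight_downs k i : (i <= k)%N -> vheight (nseq k false) i = - i%:Z.
Proof.
elim: i k => [|i IH] [|k] // ik; rewrite ?vheight0// vheight_cons IH//; lia.
Qed.

Lemma sarea_slopes k :
  (sarea 0 (nseq k true) + sarea k%:Z (nseq k false) = k ^ 2)%N.
Proof.
elim: k => [|k IH] //.
have -> : nseq k.+1 true = nseq k true ++ [:: true].
  by rewrite cats1; elim: {IH}k => //= k <-.
rewrite sarea_cat size_nseq vheight_ups//= (_ : k.+1%:Z - 1 = k%:Z); last by lia.
rewrite -!mulnn in IH *; lia.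
Qed.

Lemma size_tower k g : size (tower k g) = (k + size g + k)%N.
Proof. by rewrite !size_cat !size_nseq addnA. Qed.

Lemma tower_vheight k g : gapword k k g ->
  [/\ forall i, (i <= k)%N -> vheight (tower k g) i = i%:Z,
      forall i, (i <= k)%N -> vheight (tower k g) (size (tower k g) - i) = i%:Z
    & forall i, (i <= size (tower k g))%N -> 0 <= vheight (tower k g) i <= k%:Z].
Proof.
move=> /gapwordP[g1 g2].
have A i : (i <= k)%N -> vheight (tower k g) i = i%:Z.
  by move=> ik; rewrite vheight_catl ?size_nseq// vheight_ups.
have M j : (j <= size g)%N -> vheight (tower k g) (k + j) = k%:Z + vheight g j.
  move=> jg; rewrite -{2}(size_nseq k true) vheight_catr size_nseq vheight_ups//.
  by rewrite vheight_catl.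
have B j : (j <= k)%N -> vheight (tower k g) (k + size g + j) = k%:Z - j%:Z.
  move=> jk; rewrite -addnA -{2}(size_nseq k true) vheight_catr size_nseq vheight_ups//.
  by rewrite vheight_catr vheight_downs//; lia.
split=> // i; rewrite size_tower => ik.
  rewrite (_ : (k + size g + k - i = k + size g + (k - i))%N); last by lia.
  by rewrite B; lia.
case: (leqP i k) => i1; first by rewrite A//; lia.
case: (leqP i (k + size g)) => i2.
  by rewrite -(subnKC (ltnW i1)) M; [apply: g1; lia | lia].
by rewrite -(subnKC (ltnW i2)) B; lia.
Qed.

Lemma tower_dyck k g : gapword k k g -> is_dyck (tower k g).
Proof.
move=> kg; have [A B M] := tower_vheight kg; apply/dyckP; split.
  by move=> i /M /andP[].
by have := B 0%N isT; rewrite subn0.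
Qed.

Lemma tower_height k g : gapword k k g -> height (tower k g) = k.
Proof.
move=> kg; have [A B M] := tower_vheight kg; have ds := tower_dyck kg.
have [i si hi] := height_attained ds; have := M i si; rewrite hi.
have := @vheight_le_height (tower k g) k; rewrite A// size_tower => /(_ ltac:(lia)).
lia.
Qed.

Lemma tower_area k g : gapword k k g -> area (tower k g) = (k ^ 2 + sarea k g)%N.
Proof.
move=> /gapwordP[_ g2].
rewrite area_sarea /tower !sarea_cat size_nseq vheight_ups// add0r.
by rewrite (_ : k%:Z + vheight g (size g) = k%:Z) ?g2// -sarea_slopes; lia.
Qed.

(** The marked steps are exactly those of the two slopes, so all side gaps are empty and [g] is the
    top gap. *)
Lemma tower_water k g : gapword k k g -> (0 < k)%N ->
  water (tower k g) = sarea 0 g.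
Proof.
move=> kg k0; have [A B M] := tower_vheight kg; have ds := tower_dyck kg.
have hk := tower_height kg; have sz := size_tower k g.
have um j : (0 < j <= k)%N -> up_mark (tower k g) j = j.-1.
  move=> jk; have jh : (0 < j <= height (tower k g))%N by rewrite hk.
  have [u1 u2 u3 u4] := up_markP ds jh.
  have : (up_mark (tower k g) j < j)%N.
    by rewrite ltnNge; apply/negP => /u4; rewrite A; lia.
  by move=> uj; move: u3; rewrite A; lia.
have dm j : (0 < j <= k)%N -> down_mark (tower k g) j = (size (tower k g) - j)%N.
  move=> jk; have jh : (0 < j <= height (tower k g))%N by rewrite hk.
  have [u1 u2 u3 u4] := down_markP ds jh.
  have ge : (size (tower k g) - j <= down_mark (tower k g) j)%N.
    by rewrite leqNgt; apply/negP => lt; have := u4 (size (tower k g) - j)%N ltac:(lia); rewrite B; lia.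
  have := B (size (tower k g) - down_mark (tower k g) j)%N ltac:(lia).
  by rewrite subKn ?u3; lia.
rewrite /water hk gtn_eqF//.
rewrite big_nat big1 ?add0n => [|j jk]; last first.
  have E i (s : seq bool) : between s i i.+1 = [::].
    by rewrite /between drop_oversize// size_take; case: ifP; lia.
  have -> : left_gap (tower k g) j = [::].
    by rewrite /left_gap !um; [rewrite -{2}(@prednK j) ?E//=; lia|lia|lia].
  have -> : right_gap (tower k g) j = [::].
    rewrite /right_gap !dm; [|lia|lia].
    by rewrite (_ : (size (tower k g) - j = (size (tower k g) - j.+1).+1)%N) ?E//; lia.
  by rewrite area_reflect.
rewrite area_reflect /top_gap hk um ?dm; [|lia|lia].
rewrite /between prednK// sz /tower addnK.
by rewrite catA take_size_cat ?size_cat ?size_nseq// drop_size_cat ?size_nseq.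
Qed.

Lemma dyck_coef_ge (R : realType) (X p q : R) k m : 0 <= X -> 0 <= p -> 0 <= q ->
  (0 < k)%N ->
  X ^+ k.*2 * q ^+ (k ^ 2) *
    walk (gapstep X p q k) (gapstep X p q k) 1 k.+1
      (fun i => (i == k.+1)%:R) m.*2 k.+1
  <= X ^+ (k + m).*2 * dyck_coef p q (k + m).
Proof.
move=> X0 p0 q0 k0; set n := (k + m)%N.
rewrite -sum_gapweight /dyck_coef !mulr_sumr.
pose G (s : n.*2.-tuple bool) := X ^+ n.*2 * (p ^+ water s * q ^+ area s).
pose L := [seq (val s, G s) |
  s <- [seq s : n.*2.-tuple bool <- enum {: n.*2.-tuple bool} | is_dyck s]].
have -> : \sum_(s : n.*2.-tuple bool | is_dyck s)
    X ^+ n.*2 * (p ^+ water s * q ^+ area s) = \sum_(x <- L) x.2.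
  by rewrite big_map big_enum_filter.
apply: (sum_inj_le (g := tower k)); first exact: uniq_words.
- move=> g g' E; have sz : size g = size g'.
    by have := congr1 size E; rewrite !size_tower => /addIn/addnI.
  by move/eqP: E; rewrite /tower eqseq_cat// eqxx /= eqseq_cat// => /andP[/eqP].
- move=> g gm; rewrite gapweightE; case: ifP => [kg _|]; last by rewrite mulr0 eqxx.
  have sg := size_words gm.
  have st : size (tower k g) == n.*2.
    by rewrite size_tower sg /n doubleD -!addnn; lia.
  apply/mapP; exists (Tuple st).
    by rewrite mem_filter /= tower_dyck// mem_enum.
  congr (_, _); rewrite /G /= tower_water// tower_area// subrr sg.
  by rewrite /n doubleD !exprD; ring.
move=> x /mapP[s _ ->] /=; by rewrite !mulr_ge0 ?exprn_ge0.
Qed.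

(** * Growth of the gaps and the radius of convergence *)

(** A step is weighted by its starting point, so the step operator is not symmetric. Conjugating by
    powers of [e], the square root of [q / p], makes it [X p^k e] times the symmetric operator with
    edge weights [(q / p)^(i - 1)]. Squaring this eigenvalue yields [X^2 p^(2k - 1) q Lambda_(k+1)],
    whence the form of the branches. *)
Lemma gapstep_eigenpair (R : realType) (X p q : R) k : 0 < X -> 0 < p -> 0 < q ->
  (0 < k)%N ->
  exists mu v, [/\ eigenpair (gapstep X p q k) (gapstep X p q k) 1 k.+1 mu v,
    0 <= mu & mu ^+ 2 = X ^+ 2 / branch k p q].
Proof.
move=> X0 p0 q0; case: k => // k _; set e := Num.sqrt (q / p).
have e0 : 0 < e by rewrite sqrtr_gt0 divr_gt0.
have e2 : e ^+ 2 = q / p by rewrite sqr_sqrtr// ltW// divr_gt0.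
have [lam [v [H HL]]] := @Lambda_eigenpair R (e ^+ 2) k.+1 ltac:(by rewrite exprn_gt0).
have lam0 : 0 <= lam.
  by apply: eigenvalue_ge0 H => // i; rewrite !exprn_ge0// ltW.
exists (X * p ^+ k.+1 * e * lam), (fun i => e ^+ i * v i); split.
- have [vp vz ve] := H; split=> [i ik|i ik|[//|i] ik].
  + by rewrite mulr_gt0 ?exprn_gt0 ?vp.
  + by rewrite vz// mulr0.
  have -> : gapstep X p q k.+1 i.+1 = X * p ^+ k.+1 * (e ^+ 2) ^+ i.
    rewrite /gapstep e2 expr_div_n subSS /=.
    have ik1 : (i <= k.+1)%N by lia.
    rewrite -{2}(subnK ik1) exprD -!mulrA; congr (_ * (_ * _)).
    by rewrite mulrCA divff ?mulr1// expf_neq0// gt_eqF.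
  have -> : X * p ^+ k.+1 * e * lam * (e ^+ i.+1 * v i.+1) =
    X * p ^+ k.+1 * e * e ^+ i.+1 * (lam * v i.+1) by ring.
  rewrite -ve//=; case: i {ik} => [|i] /=.
    by rewrite (vz 0%N)// !expr0 !mulr0 !addr0 !expr1 !exprS expr0; ring.
  have h j : (e ^+ 2) ^+ j = e ^+ j * e ^+ j by rewrite exprAC expr2.
  by rewrite !h !exprS; ring.
- by rewrite !mulr_ge0 ?exprn_ge0 ?(ltW X0) ?(ltW p0) ?(ltW e0).
have HL' : Lambda k.+2 (q ^+ 2 / p ^+ 2) = lam ^+ 2 by rewrite -HL e2 expr_div_n.
rewrite /branch div1r invrK HL' !exprMn e2.
have -> : (p ^+ k.+1) ^+ 2 = p * p ^+ (2 * k.+1 - 1).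
  by rewrite -exprS -exprM; congr (_ ^+ _); lia.
by move: (p ^+ (2 * k.+1 - 1)) => P; field; rewrite gt_eqF.
Qed.

Lemma geometric_le (R : realType) (t : R) N : 0 <= t -> t < 1 ->
  \sum_(n < N) t ^+ n <= (1 - t)^-1.
Proof.
move=> t0 t1; have t1' : 0 < 1 - t by rewrite subr_gt0.
rewrite -div1r ler_pdivlMr// mulrC.
have := subrX1 t N; have := exprn_ge0 N t0; move: (t ^+ N) (\sum_(_ < _) _) => a b; lra.
Qed.

Lemma sum_gaps_le (R : realType) (X p q t : R) N k : 0 < X -> 0 < p -> 0 < q ->
  0 <= t -> t < 1 ->
  (forall j, (0 < j)%N -> X ^+ 2 / branch j p q <= t ^+ 2) ->
  \sum_(g <- gaps X p q N k) g.2 <= (1 - t)^-1.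
Proof.
move=> X0 p0 q0 t0 t1 Ht; rewrite sum_gaps.
have [mu [v [H mu0 mt]]] : exists mu v,
    [/\ eigenpair (gapstep X p q k) (gapstep X p q k) 1 k.+1 mu v, 0 <= mu & mu <= t].
  case: (posnP k) => [->|k0].
    (* At level 0 only the position 1 is available, and the eigenvalue is 0. *)
    exists 0, (fun i => (i == 1%N)%:R); split=> //; split=> [[|[|i]]//|[|[|i]]//|[|[|i]]//] _ /=.
    by rewrite !mulr0 mul0r addr0.
  have [mu [v [H mu0 mE]]] := gapstep_eigenpair X0 p0 q0 k0.
  exists mu, v; split=> //.
  by rewrite -ler_sqr ?nnegrE// mE Ht.
have c0 i : 0 <= gapstep X p q k i by rewrite !mulr_ge0 ?exprn_ge0 ?ltW.
have [vp _ _] := H; have vk : 0 < v k.+1 by apply: vp; lia.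
apply: le_trans (geometric_le N.+1 t0 t1); apply: ler_sum => n _.
(* Normalised to be 1 at [k.+1], the eigenvector dominates the indicator of that position. *)
have W := @walk_le _ _ _ _ _ (fun i => (i == k.+1)%:R) _ _ (v k.+1)^-1 c0 c0 H.
apply: le_trans (W _ n k.+1) _.
  move=> i ik; case: eqP => [->|_]; first by rewrite mulVf// gt_eqF.
  by rewrite mulr_ge0 ?invr_ge0 ?ltW// vp.
by rewrite mulrAC mulVf ?gt_eqF// mul1r lerXn2r.
Qed.

(** Write the term as [(2 Y q^h)^h 2^-h]. The base is at most 1 once [Z q^h <= 1], and the finitely
    many earlier powers are at most [Z ^+ H]; here [Z] exceeds [2 Y] by 1 so that its powers are
    monotone. *)
Lemma theta_bounded (R : realType) (Y q : R) : 0 <= Y -> 0 < q < 1 ->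
  exists B, forall M, \sum_(h < M) Y ^+ h * q ^+ (h ^ 2) <= B.
Proof.
move=> Y0 /andP[q0 q1]; pose Z := 2 * Y + 1.
have Z1 : 1 <= Z by rewrite /Z; lra.
have Z0 : 0 < Z by lra.
have [H HH] : exists H, forall h, (H <= h)%N -> Z * q ^+ h <= 1.
  have q1' : `|q| < 1 by rewrite ger0_norm// ltW.
  have e0 : 0 < Z^-1 by rewrite invr_gt0.
  have /cvgrPdist_lt/(_ _ e0)[N _ HN] := cvg_expr q1'.
  exists N => h /HN /=; rewrite sub0r normrN ger0_norm ?exprn_ge0 ?(ltW q0)// => /ltW.
  by rewrite -[leRHS]div1r ler_pdivlMr// mulrC.
exists (Z ^+ H * (1 - 2^-1)^-1) => M.
apply: (@le_trans _ _ (\sum_(h < M) Z ^+ H * 2^-1 ^+ h)); last first.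
  rewrite -mulr_sumr ler_wpM2l ?exprn_ge0 ?(ltW Z0)// geometric_le//; lra.
apply: ler_sum => h _.
have -> : Y ^+ h * q ^+ (h ^ 2) = (2 * Y * q ^+ h) ^+ h * 2^-1 ^+ h.
  rewrite -exprMn -mulnn exprM -exprMn; congr (_ ^+ h); by field.
apply: ler_wpM2r; first by rewrite exprn_ge0.
have qh : 0 <= q ^+ h by rewrite exprn_ge0// ltW.
have le1 : 2 * Y * q ^+ h <= Z * q ^+ h by rewrite ler_wpM2r// /Z; lra.
have ge0 : 0 <= 2 * Y * q ^+ h by rewrite !mulr_ge0.
case: (leqP H h) => hH.
  apply: (@le_trans _ _ 1); last by rewrite exprn_ege1.
  by rewrite exprn_ile1// (le_trans le1)// HH.
apply: (@le_trans _ _ (Z ^+ h)); last by rewrite ler_weXn2l// ltnW.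
apply: lerXn2r; rewrite ?nnegrE ?(ltW Z0)//.
by apply: le_trans le1 _; rewrite ler_piMr ?(ltW Z0)// exprn_ile1 ?(ltW q0)// ltW.
Qed.

Lemma dyck_coef_ge0 (R : realType) (p q : R) n : 0 <= p -> 0 <= q ->
  0 <= dyck_coef p q n.
Proof. by move=> p0 q0; apply: sumr_ge0 => s _; rewrite mulr_ge0 ?exprn_ge0. Qed.

Lemma pseries_dyck_cvg (R : realType) (p q x b : R) : 0 < p < 1 -> 0 < q < 1 ->
  (forall j, (0 < j)%N -> b <= branch j p q) -> 0 <= x -> x < b ->
  cvgn (pseries (dyck_coef p q) x).
Proof.
move=> /andP[p0 p1] q01 Hb x0 xb; have /andP[q0 q1] := q01.
have b0 : 0 < b by lra.
(* At [y < b] every gap eigenvalue is at most [t < 1], uniformly in the level, so the terms of the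
   series are bounded there; at [x < y] they then have a geometric majorant of ratio [x / y]. *)
have [y [y0 xy yltb]] : exists y, [/\ 0 < y, x < y & y < b].
  by exists ((x + b) / 2); split; lra.
pose t := Num.sqrt (y / b).
have t0 : 0 <= t by rewrite sqrtr_ge0.
have yb : y / b < 1 by rewrite ltr_pdivrMr// mul1r.
have t1 : t < 1 by rewrite -sqrtr1 ltr_sqrt.
have X0 : 0 < Num.sqrt y by rewrite sqrtr_gt0.
have Xy : Num.sqrt y ^+ 2 = y by rewrite sqr_sqrtr// ltW.
have HC N k : \sum_(g <- gaps (Num.sqrt y) p q N k) g.2 <= (1 - t)^-1.
  apply: sum_gaps_le => // j j0.
  rewrite Xy (sqr_sqrtr (divr_ge0 (ltW y0) (ltW b0))).
  by rewrite ler_pM2l// lef_pV2 ?posrE ?branch_gt0// Hb.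
move: HC; set C := (1 - t)^-1 => HC.
have C0 : 0 <= C by rewrite invr_ge0 subr_ge0 ltW.
have [B HB] := @theta_bounded R (y * C ^+ 2) q ltac:(by rewrite mulr_ge0 ?exprn_ge0// ltW) q01.
have bnd n : dyck_coef p q n * y ^+ n <= C * B.
  have := dyck_coef_le n (ltW X0) (ltW p0) (ltW q0) HC.
  rewrite -mul2n exprM Xy mulrC => /le_trans; apply.
  under eq_bigr do rewrite -mulrA.
  by rewrite -mulr_sumr ler_wpM2l.
have CB0 : 0 <= C * B.
  by apply: le_trans (bnd 0%N); rewrite expr0 mulr1 dyck_coef_ge0 ?ltW.
have xy0 : 0 <= x / y by rewrite divr_ge0// ltW.
apply: (@series_le_cvg _ _ (geometric (C * B) (x / y))).
- by move=> n; rewrite mulr_ge0 ?exprn_ge0// dyck_coef_ge0 ?ltW.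
- by move=> n; rewrite /geometric /= mulr_ge0 ?exprn_ge0.
- move=> n; have yn : 0 < y ^+ n by rewrite exprn_gt0.
  rewrite /geometric /= expr_div_n mulrA ler_pdivlMr// mulrAC.
  by rewrite ler_wpM2r ?exprn_ge0.
by apply: is_cvg_geometric_series; rewrite ger0_norm// ltr_pdivrMr// mul1r.
Qed.

Lemma walk_sum (R : realType) (up dn : nat -> R) lo hi g M n i :
  walk up dn lo hi (fun i => \sum_(m < M) walk up dn lo hi g m i) n i =
  \sum_(m < M) walk up dn lo hi g (n + m) i.
Proof.
elim: n i => [|n IH] i.
  rewrite /=; case: ifP => [_|/negbT H].
    by apply: eq_bigr.
  by rewrite big1// => m _; rewrite walk_out.
case: (boolP (lo <= i <= hi)%N) => H; last first.
  by rewrite walk_out// big1// => m _; rewrite walk_out.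
rewrite walkS// !IH !mulr_sumr -big_split /=; apply: eq_bigr => m _.
by rewrite H.
Qed.

Lemma walk_parity (R : realType) (up dn : nat -> R) hi e n i :
  odd (n + i) != odd e ->
  walk up dn 1 hi (fun i => (i == e)%:R) n i = 0.
Proof.
elim: n i => [|n IH] i ne.
  by rewrite /=; case: ifP => // _; case: (i =P e) ne => [->|//]; rewrite add0n eqxx.
case: (boolP (1 <= i <= hi)%N) => H; last by rewrite walk_out.
have e1 : odd (n + i.+1) != odd e by move: ne; rewrite addnS addSn.
have e2 : odd (n + i.-1) != odd e.
  by case: i H ne {e1} => // i _; rewrite /= addnS /= negbK.
by rewrite walkS// !IH// !mulr0 addr0.
Qed.

(** Towers of level [k] transfer the bound [B] to the walks of that level, whose growth rate [mu]
    satisfies [mu ^+ 2 = x / branch k p q]. Bounded walks force [mu <= 1]. *)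
Lemma branch_ge_bounded (R : realType) (p q x B : R) k : 0 < p -> 0 < q -> 0 < x ->
  (0 < k)%N -> (forall n, dyck_coef p q n * x ^+ n <= B) -> x <= branch k p q.
Proof.
move=> p0 q0 x0 k0 HB; set X := Num.sqrt x.
have X0 : 0 < X by rewrite sqrtr_gt0.
have Xx : X ^+ 2 = x by rewrite sqr_sqrtr// ltW.
set c := gapstep X p q k.
have cp i : 0 < c i by rewrite !mulr_gt0 ?exprn_gt0.
have c0 i : 0 <= c i by exact: ltW.
pose W := walk c c 1 k.+1 (fun i => (i == k.+1)%:R).
have W0 n i : 0 <= W n i by apply: walk_ge0.
pose K := X ^+ k.*2 * q ^+ (k ^ 2).
have K0 : 0 < K by rewrite mulr_gt0 ?exprn_gt0.
have B0 : 0 <= B by apply: le_trans (HB 0%N); rewrite mulr_ge0 ?dyck_coef_ge0 ?exprn_ge0 ?ltW.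
have WB n : W n k.+1 <= B / K.
  case: (boolP (odd n)) => on.
    by rewrite /W walk_parity ?divr_ge0 ?(ltW K0)// oddD on; case: odd.
  rewrite ler_pdivlMr// mulrC -(even_halfK on).
  apply: le_trans (dyck_coef_ge n./2 (ltW X0) (ltW p0) (ltW q0) k0) _.
  by rewrite -mul2n exprM Xx mulrC.
(* The indicator of [k.+1] dominates no positive multiple of [v]. Pooling the lengths up to [k]
   gives a function positive at every vertex, since [k.+1] can be reached from each of them within
   [k] steps. *)
pose S i := \sum_(m < k.+1) W m i.
have Sp i : (1 <= i <= k.+1)%N -> 0 < S i.
  move=> ik; have up j : (j <= k)%N -> 0 < W j (k.+1 - j)%N.
    elim: j => [|j IH] jk; first by rewrite /W /= subn0 leqnn /= eqxx.
    rewrite /W walkS -/W; last by lia.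
    apply: ltr_wpDr; first exact: mulr_ge0.
    apply: mulr_gt0 => //; rewrite (_ : (k.+1 - j.+1).+1 = k.+1 - j)%N; last by lia.
    by apply: IH; lia.
  have jk : (k.+1 - i < k.+1)%N by lia.
  rewrite /S (bigD1 (Ordinal jk)) //= ltr_wpDr ?sumr_ge0//.
  by have := up (k.+1 - i)%N ltac:(lia); rewrite subKn//; lia.
have [mu [v [H mu0 mE]]] := gapstep_eigenpair X0 p0 q0 k0.
have [vp _ _] := H; have vk : 0 < v k.+1 by apply: vp; lia.
have [A A0 HA] := pos_bounds Sp vp.
have mu1 : mu <= 1.
  apply: (@bounded_powers2 _ _ _ (A^-1 * v k.+1) (k.+1%:R * (B / K))) => //.
    by rewrite mulr_gt0 ?invr_gt0.
  move=> n; rewrite expr1n mulr1 mulrAC.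
  have G := @walk_ge _ _ _ _ _ S _ _ A^-1 c0 c0 H.
  apply: le_trans (G _ n k.+1) _.
    by move=> i /HA; rewrite ler_pdivrMl.
  rewrite walk_sum; apply: (@le_trans _ _ (\sum_(m < k.+1) (B / K))).
    by apply: ler_sum => m _; exact: WB.
  by rewrite sumr_const card_ord mulr_natl.
have b0 := branch_gt0 p0 q0 k0.
have : mu ^+ 2 <= 1 by rewrite exprn_ile1.
by rewrite mE Xx ler_pdivrMr// mul1r.
Qed.

Lemma radius_dyck (R : realType) (p q b : R) k : 0 < p < 1 -> 0 < q < 1 ->
  (0 < k)%N -> b = branch k p q -> (forall j, (0 < j)%N -> b <= branch j p q) ->
  radius_of_convergence (dyck_coef p q) = b%:E.
Proof.
move=> p01 q01 k0 bE Hb; have /andP[p0 p1] := p01; have /andP[q0 q1] := q01.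
have b0 : 0 < b by rewrite bE branch_gt0.
rewrite /radius_of_convergence; set S := [set _ | _ in _].
have Sub : ubound S b%:E.
  move=> _ [x /= cx <-]; rewrite lee_fin.
  have [->|xn] := eqVneq x 0; first by rewrite normr0 ltW.
  have [M [_ HM]] := cvg_seq_bounded (cvgP _ (cvg_series_cvg_0 cx)).
  rewrite bE; apply: (@branch_ge_bounded _ _ _ _ (M + 1)) => //.
    by rewrite normr_gt0.
  move=> n; have := HM (M + 1) ltac:(by rewrite ltrDl) n I.
  by rewrite /= normrM normrX ger0_norm// dyck_coef_ge0 ?ltW.
have Sin x : 0 <= x -> x < b -> S x%:E.
  move=> x0 xb; exists x; last by rewrite ger0_norm.
  exact: (pseries_dyck_cvg p01 q01 Hb x0 xb).
apply/eqP; rewrite eq_le; apply/andP; split; first exact: ge_ereal_sup.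
rewrite leNgt; apply/negP => lt.
have S0 := ereal_sup_ubound (Sin 0 (lexx 0) b0).
have : exists r, ereal_sup S = r%:E.
  by case: (ereal_sup S) S0 lt => [r _ _|//|//]; exists r.
move=> [r E]; move: S0 lt; rewrite E lee_fin lte_fin => r0 rb.
have := ereal_sup_ubound (Sin ((r + b) / 2) ltac:(lra) ltac:(lra)).
by rewrite E lee_fin; lra.
Qed.

Theorem theorem7p6 (R : realType) :
  (forall p q : R, 0 < p < 1 -> 0 < q < 1 ->
     exists k : nat,
       [/\ (1 <= k)%N,
           forall j : nat, (1 <= j)%N -> branch k p q <= branch j p q
         & radius_of_convergence (dyck_coef p q) = (branch k p q)%:E])
  /\
  (forall (r : R) (I : set R), 0 < r ->
     is_interval I ->
     I `<=` [set s | 0 < s < Num.min 1 r^-1] ->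
     (forall k : nat, (1 <= k)%N -> ~ I (sigma k r)) ->
     forall s t : R, I s -> I t ->
       active (Num.sqrt s) (Num.sqrt (r * s))
       = active (Num.sqrt t) (Num.sqrt (r * t)))
  /\
  (forall k : nat, (1 <= k)%N ->
     crossing R k =
     [set pq : R * R | 0 < pq.1 /\ 0 < pq.2 /\
        exists r : R,
          [/\ 0 < r, sigma k r < Num.min 1 r^-1,
              pq.1 ^+ 2 = sigma k r & pq.2 ^+ 2 = r * sigma k r]])
  /\
  (forall k : nat, (1 <= k)%N ->
     [set (pq.2, pq.1) | pq in crossing R k] = crossing R k).
Proof.
split; [|split; [|split]].
- move=> p q p01 q01; have [k k1 kmin] := branch_min p01 q01.
  exists k; split; [exact: k1 | exact: kmin |].
  exact: (radius_dyck p01 q01 k1 erefl kmin).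
- exact: active_constant.
- exact: crossing_param.
- exact: crossing_sym.
Qed.
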